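(* Let $\eta\in\Upsilon_{z_0}$, with $\mathsf{w}(\eta)=\cdots s_{i_1}s_{i_0}$ and period $N=N_\eta$. Let $(u_M,M)\in\widetilde W\times\mathbb{Z}/N\mathbb{Z}$ and $(v_M,M)\in\widehat W\times\mathbb{Z}/N\mathbb{Z}$ denote the states at time $M$ of $\widetilde{\mathbf M}_\eta$ and $\widehat{\mathbf M}_\eta$, respectively. Let \[\psi_\eta=\sum_{\substack{(w,k)\in W\times\mathbb{Z}/N\mathbb{Z}\\ i_k=0\\ w^{-1}\theta\in\Phi^+}}\zeta_\eta(w,k)\,\theta^\vee w .\] Then with probability $1$, $\lim_{M\to\infty}\langle\mathcal{A} v_M\rangle=\langle\psi_\eta\rangle$. Moreover, with probability $1$ the limit $\lim_{M\to\infty}\langle\mathcal{A} u_M\rangle$ exists and belongs to $\langle\psi_\eta\rangle W=\{\langle\psi_\eta\rangle w: w\in W\}$.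
   Context: Let $\Phi$ be a finite irreducible crystallographic root system spanning a Euclidean space $V$, with positive roots $\Phi^+$, simple roots $\{\alpha_i:i\in I\}$, highest root $\theta$, Weyl group $W$ (acting on $V$ on the left, $\beta\mapsto w\beta$) and affine Weyl group $\widetilde W$ with simple reflections $s_i$, $i\in\widetilde I=\{0\}\sqcup I$. Each root $\beta$ has a coroot $\beta^\vee\in V^*$; $Q^\vee=\mathrm{span}_{\mathbb Z}\{\beta^\vee:\beta\in\Phi\}$. For $\beta\in\Phi^+$, $k\in\mathbb Z$, let $\mathrm H_\beta^k=\{\gamma\in V^*:\gamma(\beta)=k\}$ and $\mathcal H_{\widetilde W}=\{\mathrm H_\beta^k\}$. The group $\widetilde W$ acts faithfully on $V^*$ on the right: $s_i$ ($i\in I$) acts by reflection through $\mathrm H^0_{\alpha_i}$, and $s_0$ by reflection through $\mathrm H^1_\theta$; $W=\langle s_i:i\in I\rangle\subseteq\widetilde W$. The fundamental chamber is $\mathcal C=\{\gamma\in V^*:\gamma(\alpha_i)\ge 0\ \forall i\in I\}$ and the fundamental alcove is $\mathcal A=\{\gamma\in\mathcal C:\gamma(\theta)\le1\}$; $u\mapsto\mathcal A u$ is a bijection from $\widetilde W$ to the alcoves (closures of connected components of $V^*\setminus\bigcup\mathcal H_{\widetilde W}$). For $u\in\widetilde W$ and $i\in\widetilde I$, $\mathrm H^{(u,s_i)}$ is the hyperplane of $\mathcal H_{\widetilde W}$ separating $\mathcal A u$ and $\mathcal A s_iu$. Each $w\in\widetilde W$ factors uniquely as $w=\overline w\,\tau_\xi$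 with $\overline w\in W$, $\xi\in Q^\vee$, where $\tau_\xi$ acts by $\gamma\mapsto\gamma-\xi$. Let $\widehat W=\{w\in\widetilde W:\mathcal A w\subseteq\mathcal C\}$. For nonzero $\gamma\in V^*$, $\langle\gamma\rangle=\gamma/\|\gamma\|$, and $\langle\mathcal A u\rangle$ is the unit vector pointing toward the center of $\mathcal A u$. Fix $z_0$ in the interior of $\mathcal A$ and $p\in(0,1)$. $\Upsilon_{z_0}$ is the set of $\eta\in Q^\vee\setminus\{0\}$ such that the ray from $z_0$ in direction $\eta$ passes through no intersection of two or more hyperplanes of $\mathcal H_{\widetilde W}$. For such $\eta$, if the ray passes successively through alcoves $\mathcal A u_0=\mathcal A,\mathcal A u_1,\mathcal A u_2,\dots$, let $i_j\in\widetilde I$ be defined by $u_{j+1}=s_{i_j}u_j$, and $\mathsf w(\eta)=\cdots s_{i_1}s_{i_0}$; the sequence $(i_j)$ is periodic with period $N_\eta$, and $i_k$ is read with $k\in\mathbb Z/N_\eta\mathbb Z$. $\widetilde{\mathbf M}_\eta$ (reduced random combinatorial billiard trajectory) is the Markov chain on $\widetilde W\times\mathbb Z/N_\eta\mathbb Z$ started at $(\mathbbm 1,0)$ where, from state $(u,k)$: if $\mathrm H^{(u,s_{i_k})}$ does not separate $\mathcal A u$ from $\mathcal A$, it moves to $(s_{i_k}u,k+1)$ with probability $p$ and to $(u,k+1)$ with probability $1-p$; otherwise it moves to $(u,k+1)$ with probability $1$. (This discretizes a beam of light shone from $z_0$ in direction $\eta$ that passes through each not-yet-crossed hyperplane it hits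 with probability $p$ and otherwise reflects.) $\widehat{\mathbf M}_\eta$ is the Markov chain on $\widehat W\times\mathbb Z/N_\eta\mathbb Z$ defined identically except that the move to $(s_{i_k}u,k+1)$ (with probability $p$) is allowed only if additionally $\mathcal A s_{i_k}u\subseteq\mathcal C$; otherwise it moves to $(u,k+1)$. The image of $\widehat{\mathbf M}_\eta$ under $(w,k)\mapsto(\overline w,k)$ is a Markov chain $\mathbf M_\eta$ on $W\times\mathbb Z/N_\eta\mathbb Z$, assumed irreducible; $\zeta_\eta$ denotes its stationary distribution. *)

(* Defs.v *)
From HB Require Import structures.
From mathcomp Require Import all_boot all_order all_algebra.
From mathcomp Require Import all_classical all_reals all_analysis.
Set Implicit Arguments. Unset Strict Implicit. Unset Printing Implicit Defensive.
Import numFieldNormedType.Exports.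
Import Order.TTheory GRing.Theory Num.Theory.
Local Open Scope classical_set_scope.
Local Open Scope ring_scope.

Section AffineWeyl.
Variables (R : realType) (n : nat).
Variables (Phi : seq 'rV[R]_n) (Delta : 'I_n -> 'rV[R]_n) (theta : 'rV[R]_n).

(* V = 'rV_n with the standard inner product; the dual space is identified with V via
   this inner product, so gamma(beta) = ip gamma beta. *)
Definition ip (x y : 'rV[R]_n) : R := \sum_(j < n) x 0 j * y 0 j.
Definition coroot (b : 'rV[R]_n) : 'rV[R]_n := (2 / ip b b) *: b.

Definition nncomb (b : 'rV[R]_n) : Prop :=
  exists c : 'I_n -> nat, b = \sum_(a < n) (c a)%:R *: Delta a.

Definition irreducible_rs : Prop :=
  forall Q : set 'rV[R]_n,
    (forall a b, a \in Phi -> b \in Phi -> Q a -> ~ Q b -> ip a b = 0) ->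
    (forall a, a \in Phi -> Q a) \/ (forall a, a \in Phi -> ~ Q a).

Definition root_system : Prop :=
  [/\ (0 \notin Phi),
      (forall a b, a \in Phi -> b \in Phi -> b - ip b (coroot a) *: a \in Phi),
      (forall a b, a \in Phi -> b \in Phi -> exists z : int, ip b (coroot a) = z%:~R),
      (forall a (c : R), a \in Phi -> c *: a \in Phi -> c = 1 \/ c = -1)
    & irreducible_rs] /\
  [/\ (forall a, Delta a \in Phi), row_free (\matrix_(a < n) Delta a),
      (forall b, b \in Phi -> nncomb b \/ nncomb (- b)),
      theta \in Phi
    & (forall b, b \in Phi -> nncomb (theta - b))].

Definition posroot (b : 'rV[R]_n) : Prop := b \in Phi /\ nncomb b.

(* affine maps gamma |-> gamma *m f.1 + f.2 (right action on the dual space) *)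
Definition aff := ('M[R]_n * 'rV[R]_n)%type.
Definition affapp (f : aff) (g : 'rV[R]_n) : 'rV[R]_n := g *m f.1 + f.2.
Definition affthen (f g : aff) : aff := (f.1 *m g.1, f.2 *m g.1 + g.2).
Definition reflmx (b : 'rV[R]_n) : 'M[R]_n := 1%:M - b^T *m coroot b.
Definition aff_refl (b : 'rV[R]_n) (k : R) : aff := (reflmx b, k *: coroot b).

(* index set I~ = 'I_n.+1 : 0 is the affine node, lift ord0 a is alpha_a *)
Definition sref (j : 'I_n.+1) : aff :=
  match unlift ord0 j with
  | Some a => aff_refl (Delta a) 0
  | None => aff_refl theta 1
  end.

(* a word [:: j1; ...; jm] represents s_j1 ... s_jm in W~; the right action
   is gamma . (s_j u) = (gamma . s_j) . u *)
Fixpoint word_aff (w : seq 'I_n.+1) : aff :=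
  match w with
  | [::] => (1%:M, 0)
  | j :: w' => affthen (sref j) (word_aff w')
  end.
Definition lin (w : seq 'I_n.+1) : 'M[R]_n := (word_aff w).1.

Definition alcA : set 'rV[R]_n :=
  [set g | (forall a, 0 <= ip g (Delta a)) /\ ip g theta <= 1].
Definition chamberC : set 'rV[R]_n := [set g | forall a, 0 <= ip g (Delta a)].
Definition alc (w : seq 'I_n.+1) : set 'rV[R]_n := affapp (word_aff w) @` alcA.

Definition Wset : set 'M[R]_n :=
  [set w | exists u : seq 'I_n, w = lin (map (lift ord0) u)].

(* hyperplane H_b^k separates the (full-dimensional) sets X and Y *)
Definition separates (b : 'rV[R]_n) (k : int) (X Y : set 'rV[R]_n) : Prop :=
  (X `<=` [set g | k%:~R <= ip g b] /\ Y `<=` [set g | ip g b <= k%:~R]) \/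
  (X `<=` [set g | ip g b <= k%:~R] /\ Y `<=` [set g | k%:~R <= ip g b]).

Definition wall_sep (u : seq 'I_n.+1) (j : 'I_n.+1) : Prop :=
  exists b k, posroot b /\ separates b k (alc u) (alc (j :: u))
              /\ separates b k (alc u) (alc [::]).

(* center of alcoves: barycenter of the vertices 0 and vert a of A *)
Definition vert (a : 'I_n) : 'rV[R]_n :=
  xget 0 [set g | (forall a', a' != a -> ip g (Delta a') = 0) /\ ip g theta = 1].
Definition centerA : 'rV[R]_n := (n.+1%:R)^-1 *: \sum_(a < n) vert a.
Definition alc_center (w : seq 'I_n.+1) : 'rV[R]_n := affapp (word_aff w) centerA.
Definition unitv (g : 'rV[R]_n) : 'rV[R]_n := (Num.sqrt (ip g g))^-1 *: g.

Definition upsilon (z0 eta : 'rV[R]_n) : Prop :=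
  eta != 0 /\
  (exists c : 'I_(size Phi) -> int,
      eta = \sum_(j < size Phi) (c j)%:~R *: coroot (Phi`_j)) /\
  (forall s : R, 0 <= s -> forall b b' (k k' : int), posroot b -> posroot b' ->
      (b, k) != (b', k') ->
      ~ (ip (z0 + s *: eta) b = k%:~R /\ ip (z0 + s *: eta) b' = k'%:~R)).

Definition interior_A (z0 : 'rV[R]_n) : Prop :=
  (forall a, 0 < ip z0 (Delta a)) /\ ip z0 theta < 1.

Definition pref (i : nat -> 'I_n.+1) (j : nat) : seq 'I_n.+1 :=
  rev (map i (iota 0 j)).

Definition billiard_word (z0 eta : 'rV[R]_n) (i : nat -> 'I_n.+1) : Prop :=
  exists t : nat -> R,
    [/\ t 0%N = 0, (forall j, t j < t j.+1), (forall M : R, exists j, M < t j)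
      & forall j (s : R), t j <= s -> s <= t j.+1 -> alc (pref i j) (z0 + s *: eta)].

Definition period (i : nat -> 'I_n.+1) (N : nat) : Prop :=
  (0 < N)%N /\ (forall j, i (j + N)%N = i j) /\
  (forall N', (0 < N')%N -> (forall j, i (j + N')%N = i j) -> (N <= N')%N).

(* transition kernels; the Z/NZ component is a nat k < N *)
Definition trans_tilde (i : nat -> 'I_n.+1) (N : nat) (p : R)
    (x y : seq 'I_n.+1 * nat) : R :=
  let j := i x.2 in let k1 := (x.2.+1 %% N)%N in
  if `[< ~ wall_sep x.1 j >] then
    p * (y == (j :: x.1, k1))%:R + (1 - p) * (y == (x.1, k1))%:R
  else (y == (x.1, k1))%:R.

Definition hat_ok (u : seq 'I_n.+1) (j : 'I_n.+1) : Prop :=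
  ~ wall_sep u j /\ alc (j :: u) `<=` chamberC.

Definition trans_hat (i : nat -> 'I_n.+1) (N : nat) (p : R)
    (x y : seq 'I_n.+1 * nat) : R :=
  let j := i x.2 in let k1 := (x.2.+1 %% N)%N in
  if `[< hat_ok x.1 j >] then
    p * (y == (j :: x.1, k1))%:R + (1 - p) * (y == (x.1, k1))%:R
  else (y == (x.1, k1))%:R.

(* the image chain M_eta on W x Z/NZ: from (w,k), move as the hat chain does
   from some v in W^ with \overline v = w *)
Definition hat_repr (w : 'M[R]_n) : seq 'I_n.+1 :=
  xget [::] [set v | alc v `<=` chamberC /\ lin v = w].

Definition trans_W (i : nat -> 'I_n.+1) (N : nat) (p : R)
    (x y : 'M[R]_n * nat) : R :=
  let v := hat_repr x.1 in let j := i x.2 in let k1 := (x.2.+1 %% N)%N in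
  if `[< hat_ok v j >] then
    p * (y == (lin (j :: v), k1))%:R + (1 - p) * (y == (x.1, k1))%:R
  else (y == (x.1, k1))%:R.

Definition Mstates (N : nat) : set ('M[R]_n * nat) :=
  [set x | Wset x.1 /\ (x.2 < N)%N].

Definition irreducible_W (i : nat -> 'I_n.+1) (N : nat) (p : R) : Prop :=
  forall x y, Mstates N x -> Mstates N y ->
    exists (m : nat) (f : nat -> 'M[R]_n * nat),
      [/\ f 0%N = x, f m = y & forall j, (j < m)%N -> 0 < trans_W i N p (f j) (f j.+1)].

Definition stationary_W (i : nat -> 'I_n.+1) (N : nat) (p : R)
    (zeta : 'M[R]_n * nat -> R) : Prop :=
  [/\ (forall x, Mstates N x -> 0 <= zeta x),
      \sum_(x \in Mstates N) zeta x = 1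
    & forall y, Mstates N y ->
        zeta y = \sum_(x \in Mstates N) zeta x * trans_W i N p x y].

Definition psi (i : nat -> 'I_n.+1) (N : nat) (zeta : 'M[R]_n * nat -> R)
    : 'rV[R]_n :=
  \sum_(k < N | i k == ord0)
     \sum_(w \in [set w | Wset w /\ posroot (theta *m (invmx w)^T)])
        zeta (w, val k) *: (coroot theta *m w).

End AffineWeyl.

Definition markov_chain (R : realType) d (Omega : measurableType d)
    (P : probability Omega R) (S : eqType) (X : nat -> Omega -> S) (x0 : S)
    (T : S -> S -> R) : Prop :=
  (forall m x, measurable [set w | X m w = x]) /\
  forall xs : seq S, (0 < size xs)%N ->
    P [set w | forall j, (j < size xs)%N -> X j w = nth x0 xs j] =
    (((head x0 xs == x0)%:R *
      \prod_(j < (size xs).-1) T (nth x0 xs j) (nth x0 xs j.+1)) : R)%:E.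

(* Main.v *)
Require Import Defs.
From HB Require Import structures.
From mathcomp Require Import all_boot all_order all_algebra finmap.
From mathcomp Require Import all_classical all_reals all_analysis.
From mathcomp Require Import ring lra.
Set Implicit Arguments. Unset Strict Implicit. Unset Printing Implicit Defensive.
Import numFieldNormedType.Exports.
Import Order.TTheory GRing.Theory Num.Theory.
Local Open Scope classical_set_scope.
Local Open Scope ring_scope.

(** Write an element of the affine Weyl group as [g |-> g *m w + c].  For an alcove [A v] in
    the chamber, crossing its wall of type [j] is allowed for the hat chain exactly when the
    root [a_j *m w] is negative, where [a_j] is the simple root or [- theta]; hence [lin v]
    is itself Markov, and [c] changes only at the affine letter, by [coroot theta *m w].
    Let [h] solve the Poisson equation of the finite irreducible chain [M_eta] for the mean
    increment of [c].  Then [c + h] has constant drift [p *: psi] and bounded increments, so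
    a fourth moment bound and Borel-Cantelli give [c / M --> p *: psi] almost surely.  The
    vector [psi] is nonzero since it is a combination of positive coroots with positive
    coefficients, so directions converge.

    An alcove of the tilde chain is [A v *m x] with [A v] in the chamber and [x] in W; the
    part [v] moves as the hat chain, while each change of [x] strictly decreases
    [ip (z0 *m x) z0].  As W is finite, [x] is eventually constant. *)

(** Feeds integrality to [lra], which sees only an ordered field; it is instantiated wherever an
    integer level has to be pinned down. *)
Lemma intr_ltD1 (R : realType) (k l : int) : k%:~R < l%:~R :> R -> k%:~R + 1 <= l%:~R :> R.
Proof. by rewrite ltr_int -lezD1 -(ler_int R) rmorphD. Qed.

(** * Inner products and reflections as matrices acting on the right *)

Section InnerProduct.
Variables (R : realType) (n : nat).
Implicit Types (x y b : 'rV[R]_n) (w : 'M[R]_n).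

Lemma ipE x y : ip x y = (x *m y^T) 0 0.
Proof. by rewrite mxE; apply: eq_bigr => j _; rewrite mxE. Qed.

Lemma ipC x y : ip x y = ip y x.
Proof. by apply: eq_bigr => j _; rewrite mulrC. Qed.

Lemma ipDl x y z : ip (x + y) z = ip x z + ip y z.
Proof. by rewrite !ipE mulmxDl mxE. Qed.

Lemma ipZl c x y : ip (c *: x) y = c * ip x y.
Proof. by rewrite !ipE -scalemxAl mxE. Qed.

Lemma ipNl x y : ip (- x) y = - ip x y.
Proof. by rewrite !ipE mulNmx mxE. Qed.

Lemma ipBl x y z : ip (x - y) z = ip x z - ip y z.
Proof. by rewrite ipDl ipNl. Qed.

Lemma ip0l x : ip 0 x = 0.
Proof. by rewrite ipE mul0mx mxE. Qed.

Lemma ipDr x y z : ip z (x + y) = ip z x + ip z y.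
Proof. by rewrite ipC ipDl !(ipC z). Qed.

Lemma ipZr c x y : ip y (c *: x) = c * ip y x.
Proof. by rewrite ipC ipZl (ipC y). Qed.

Lemma ipNr x y : ip y (- x) = - ip y x.
Proof. by rewrite ipC ipNl (ipC y). Qed.

Lemma ipBr x y z : ip z (x - y) = ip z x - ip z y.
Proof. by rewrite ipDr ipNr. Qed.

Lemma ip_sumr (I : Type) (r : seq I) (Q : pred I) (F : I -> 'rV[R]_n) x :
  ip x (\sum_(a <- r | Q a) F a) = \sum_(a <- r | Q a) ip x (F a).
Proof.
elim/big_rec2: _ => [|a y1 y2 _ IH]; first by rewrite ipC ip0l.
by rewrite ipDr IH.
Qed.

Lemma ip_mulmxl x y w : ip (x *m w) y = ip x (y *m w^T).
Proof. by rewrite !ipE trmx_mul trmxK mulmxA. Qed.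

Lemma ip_orth x y w : w *m w^T = 1%:M -> ip (x *m w) (y *m w) = ip x y.
Proof. by move=> wK; rewrite ip_mulmxl -mulmxA wK mulmx1. Qed.

Lemma ip_gt0 x : x != 0 -> 0 < ip x x.
Proof.
move=> x0; rewrite lt_def; apply/andP; split; last first.
  by apply: sumr_ge0 => j _; rewrite -expr2 sqr_ge0.
apply: contra x0 => /eqP xx0; apply/eqP/rowP => j; rewrite mxE.
have ge0 (k : 'I_n) : true -> 0 <= x 0 k * x 0 k by rewrite -expr2 sqr_ge0.
by have /eqP := @psumr_eq0P _ _ _ _ ge0 xx0 j isT; rewrite mulf_eq0 orbb => /eqP.
Qed.

Lemma mulmx_ext (v w : 'M[R]_n) : (forall x, x *m v = x *m w) -> v = w.
Proof. by move=> vw; apply/row_matrixP => a; rewrite !rowE. Qed.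

Lemma reflmxE x b : x *m reflmx b = x - ip x b *: coroot b.
Proof.
rewrite /reflmx mulmxBr mulmx1 mulmxA [x *m b^T]mx11_scalar mul_scalar_mx.
by rewrite ipE.
Qed.

Lemma reflmx_ip x b : x *m reflmx b = x - ip x (coroot b) *: b.
Proof. by rewrite reflmxE /coroot ipZr scalerA [_ * ip x b]mulrC. Qed.

Lemma tr_reflmx b : (reflmx b)^T = reflmx b.
Proof.
by rewrite /reflmx /coroot linearB /= trmx1 trmx_mul trmxK linearZ /= -scalemxAl -scalemxAr.
Qed.

Lemma corootN b : coroot (- b) = - coroot b.
Proof. by rewrite /coroot ipNl ipNr opprK scalerN. Qed.

Lemma reflmxN b : reflmx (- b) = reflmx b.
Proof. by rewrite /reflmx corootN [(- b)^T]linearN /= mulNmx mulmxN opprK. Qed.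

Lemma ip_coroot b : b != 0 -> ip b (coroot b) = 2.
Proof. by move=> /ip_gt0/lt0r_neq0 b0; rewrite ipZr divfK. Qed.

Lemma reflmx_self b : b != 0 -> b *m reflmx b = - b.
Proof.
by move=> b0; rewrite reflmx_ip ip_coroot // scaler_nat mulr2n opprD addrA subrr add0r.
Qed.

Lemma reflmxK b : b != 0 -> reflmx b *m reflmx b = 1%:M.
Proof.
move=> b0; apply: mulmx_ext => x; rewrite mulmxA mulmx1 !reflmx_ip ipBl ipZl ip_coroot //.
set t := ip x _; rewrite -addrA -opprD -scalerDl.
have -> : t + (t - t * 2) = 0 by ring.
by rewrite scale0r subr0.
Qed.

Lemma reflmx_orth b : b != 0 -> reflmx b *m (reflmx b)^T = 1%:M.
Proof. by move=> b0; rewrite tr_reflmx reflmxK. Qed.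

Lemma coroot_mulmx b w : w *m w^T = 1%:M -> coroot (b *m w) = coroot b *m w.
Proof. by move=> wK; rewrite /coroot ip_orth // -scalemxAl. Qed.

Lemma reflmx_conj b w : w *m w^T = 1%:M -> reflmx b *m w = w *m reflmx (b *m w).
Proof.
move=> wK; apply: mulmx_ext => x; rewrite !mulmxA !reflmxE mulmxBl -scalemxAl.
by rewrite ip_orth // coroot_mulmx.
Qed.

End InnerProduct.

(** * Roots, reflections and alcoves *)

Section RootSystem.
Variables (R : realType) (n : nat).
Variables (Phi : seq 'rV[R]_n) (Delta : 'I_n -> 'rV[R]_n) (theta : 'rV[R]_n).
Hypothesis HPhi : root_system Phi Delta theta.
Implicit Types (b g x : 'rV[R]_n) (w : 'M[R]_n) (u v : seq 'I_n.+1) (j : 'I_n.+1).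

Lemma root_neq0 b : b \in Phi -> b != 0.
Proof.
by case: HPhi => [[H0 _ _ _ _] _] bP; apply: contraNneq H0 => <-.
Qed.

Lemma root_refl a b : a \in Phi -> b \in Phi -> b *m reflmx a \in Phi.
Proof. by case: HPhi => [[_ H _ _ _] _] aP bP; rewrite reflmx_ip H. Qed.

Lemma rootN b : b \in Phi -> - b \in Phi.
Proof. by move=> bP; rewrite -reflmx_self ?root_neq0 // root_refl. Qed.

Lemma root_Delta a : Delta a \in Phi.
Proof. by case: HPhi => _ []. Qed.

Lemma root_theta : theta \in Phi.
Proof. by case: HPhi => _ []. Qed.

Lemma root_int a b : a \in Phi -> b \in Phi -> exists z : int, ip b (coroot a) = z%:~R.
Proof. by case: HPhi => [[_ _ H _ _] _]; apply: H. Qed.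

Lemma root_sign b : b \in Phi -> nncomb Delta b \/ nncomb Delta (- b).
Proof. by case: HPhi => _ [_ _ H _ _]; apply: H. Qed.

Lemma theta_highest b : b \in Phi -> nncomb Delta (theta - b).
Proof. by case: HPhi => _ [_ _ _ _ H]; apply: H. Qed.

Lemma ip_nncomb_ge0 g b :
  (forall a, 0 <= ip g (Delta a)) -> nncomb Delta b -> 0 <= ip g b.
Proof.
move=> gp [c ->]; rewrite ip_sumr; apply: sumr_ge0 => a _.
by rewrite ipZr mulr_ge0.
Qed.

Lemma ip_nncomb_gt0 g b :
  (forall a, 0 < ip g (Delta a)) -> b != 0 -> nncomb Delta b -> 0 < ip g b.
Proof.
move=> gp b0 bp; rewrite lt_def ip_nncomb_ge0 ?andbT //; last by move=> a; apply: ltW.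
case: bp => c bE; apply: contra b0 => /eqP gb0.
have ca a : (c a)%:R = 0 :> R.
  have ge0 (a' : 'I_n) : true -> 0 <= (c a')%:R * ip g (Delta a').
    by move=> _; rewrite mulr_ge0 // ltW.
  have sum0 : \sum_a' (c a')%:R * ip g (Delta a') = 0.
    by rewrite -[RHS]gb0 bE ip_sumr; apply: eq_bigr => a' _; rewrite ipZr.
  have /eqP := @psumr_eq0P _ _ _ _ ge0 sum0 a isT.
  by rewrite mulf_eq0 (gt_eqF (gp a)) orbF => /eqP.
by rewrite bE big1 // => a _; rewrite ca scale0r.
Qed.

(** The [n] independent simple roots form a basis, so values on them can be prescribed. This yields
    below the sum of the coordinates off [a], and the height. *)
Lemma dual_vector (f : 'I_n -> R) : exists g, forall a, ip g (Delta a) = f a.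
Proof.
case: HPhi => _ [_ Hfree _ _ _]; set D := \matrix_(a < n) Delta a in Hfree.
have DU : D \in unitmx by rewrite -row_free_unit.
exists ((\row_a f a) *m (invmx D)^T) => a.
rewrite ip_mulmxl trmxK -[Delta a](rowK Delta) -/D rowE -mulmxA mulmxV // mulmx1.
rewrite ipE mxE (bigD1 a) //= big1 ?addr0 => [|k ka]; rewrite !mxE !eqxx.
  by rewrite mulr1.
by rewrite (negPf ka) mulr0.
Qed.

(* A positive root other than [Delta a] has a positive coordinate off [a], which the
   reflection in [Delta a] does not change. *)
Lemma refl_Delta_pos a b : b \in Phi -> nncomb Delta b -> b != Delta a ->
  nncomb Delta (b *m reflmx (Delta a)).
Proof.
move=> bP bp ba.
have [//|[d dE]] := root_sign (root_refl (root_Delta a) bP).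
case: (bp) => c cE.
have [f fE] := dual_vector (fun k => (k != a)%:R).
have fge k : 0 <= ip f (Delta k) by rewrite fE ler0n.
have f_c (c' : 'I_n -> nat) : ip f (\sum_k (c' k)%:R *: Delta k) = (\sum_(k | k != a) c' k)%:R.
  rewrite ip_sumr natr_sum [RHS]big_mkcond; apply: eq_bigr => k _.
  by rewrite ipZr fE; case: eqP; rewrite ?mulr1 ?mulr0.
have ipfb : ip f (b *m reflmx (Delta a)) = ip f b.
  by rewrite reflmx_ip ipBr ipZr fE eqxx mulr0 subr0.
have fb0 : ip f b = 0.
  apply/le_anti; rewrite ip_nncomb_ge0 // andbT -ipfb -oppr_ge0 -ipNr.
  by apply: ip_nncomb_ge0 => //; exists d.
have c0 k : k != a -> c k = 0%N.
  move=> ka; move: fb0; rewrite cE f_c => /eqP; rewrite pnatr_eq0 sum_nat_eq0.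
  by move=> /forallP/(_ k); rewrite ka => /eqP.
have bE : b = (c a)%:R *: Delta a.
  by rewrite cE (bigD1 a) //= big1 ?addr0 // => k /c0 ->; rewrite scale0r.
(* Now [b] is a natural multiple of [Delta a]. As the system is reduced the factor is 1, excluded by
   [ba], or -1, excluded by sign. *)
case: HPhi => [[_ _ _ Hred _] _].
have := Hred (Delta a) (c a)%:R (root_Delta a); rewrite -bE => /(_ bP) [c1|c1].
  by move: ba; rewrite bE c1 scale1r eqxx.
by have := ler0n R (c a); rewrite c1; lra.
Qed.

(** * Simple reflections of the affine group, one root and one level per letter *)

Definition aroot j : 'rV[R]_n := if unlift ord0 j is Some a then Delta a else - theta.
(** The fundamental alcove is where [ip g (aroot j) + alevel j] is nonnegative for every [j]; with
    the sign [- theta] the affine node needs no separate treatment. *)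
Definition alevel j : R := if unlift ord0 j is Some _ then 0 else 1.

Lemma root_aroot j : aroot j \in Phi.
Proof. by rewrite /aroot; case: unlift => [a|]; rewrite ?root_Delta ?rootN ?root_theta. Qed.

Lemma srefE j : sref Delta theta j = aff_refl (aroot j) (- alevel j).
Proof.
rewrite /sref /aroot /alevel; case: unlift => [a|]; rewrite ?oppr0 //.
by rewrite /aff_refl reflmxN corootN scalerN scaleNr opprK.
Qed.

Notation lin := (lin Delta theta).
Notation word_aff := (word_aff Delta theta).
Notation alc := (alc Delta theta).
Notation alcA := (alcA Delta theta).
Notation Wset := (Wset Delta theta).
Definition trans u : 'rV[R]_n := (word_aff u).2.

Lemma lin_cons j u : lin (j :: u) = reflmx (aroot j) *m lin u.
Proof. by rewrite /Defs.lin /= srefE. Qed.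

Lemma trans_cons j u :
  trans (j :: u) = trans u - alevel j *: (coroot (aroot j) *m lin u).
Proof. by rewrite /trans /= srefE /= scaleNr mulNmx -scalemxAl addrC. Qed.

Lemma lin_cat u v : lin (u ++ v) = lin u *m lin v.
Proof.
by elim: u => [|j u IH]; rewrite ?mul1mx //= !lin_cons IH mulmxA.
Qed.

Lemma lin_orth u : lin u *m (lin u)^T = 1%:M.
Proof.
elim: u => [|j u IH]; first by rewrite /Defs.lin /= trmx1 mulmx1.
rewrite lin_cons trmx_mul mulmxA -[_ *m _ *m (lin u)^T]mulmxA IH mulmx1.
by rewrite reflmx_orth // root_neq0 // root_aroot.
Qed.

Lemma invmx_lin u : invmx (lin u) = (lin u)^T.
Proof.
have [lu _] := mulmx1_unit (lin_orth u).
by rewrite -[LHS]mulmx1 -(lin_orth u) mulmxA mulVmx // mul1mx.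
Qed.

Lemma root_lin b u : b \in Phi -> b *m lin u \in Phi.
Proof.
elim: u b => [|j u IH] b bP; first by rewrite /Defs.lin /= mulmx1.
by rewrite lin_cons mulmxA IH // root_refl // root_aroot.
Qed.

Lemma root_lin_tr b u : b \in Phi -> b *m (lin u)^T \in Phi.
Proof.
elim: u => [|j u IH] bP; first by rewrite /Defs.lin /= trmx1 mulmx1.
by rewrite lin_cons trmx_mul mulmxA tr_reflmx root_refl ?root_aroot // IH.
Qed.

Lemma mulmx_lin_trK b u : b *m (lin u)^T *m lin u = b.
Proof. by rewrite -mulmxA (mulmx1C (lin_orth u)) mulmx1. Qed.

Lemma mulmx_linK b u : b *m lin u *m (lin u)^T = b.
Proof. by rewrite -mulmxA lin_orth mulmx1. Qed.

(** Only the affine letter changes the translation, by the image of a coroot, and roots pair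
    integrally with coroots. *)
Lemma trans_int b u : b \in Phi -> exists z : int, ip (trans u) b = z%:~R.
Proof.
move=> bP; elim: u => [|j u [z zE]]; first by exists 0; rewrite /trans /= ip0l.
have [y yE] := root_int (root_aroot j) (root_lin_tr u bP).
rewrite trans_cons ipBl ipZl ip_mulmxl (ipC (coroot _)) yE zE /alevel; case: unlift => [a|].
  by exists z; rewrite mul0r subr0.
by exists (z - y); rewrite mul1r rmorphB.
Qed.

Lemma affappE u g : affapp (word_aff u) g = g *m lin u + trans u.
Proof. by []. Qed.

(** * The finite Weyl group *)

Lemma WsetM w w' : Wset w -> Wset w' -> Wset (w *m w').
Proof. by case=> u -> [u' ->]; exists (u ++ u'); rewrite map_cat lin_cat. Qed.

Lemma Wset1 : Wset 1%:M.
Proof. by exists [::]. Qed.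

Lemma Wset_lin w : Wset w -> exists u, w = lin u.
Proof. by case=> u ->; eexists. Qed.

Lemma aroot_lift a : aroot (lift ord0 a) = Delta a.
Proof. by rewrite /aroot liftK. Qed.

Lemma Wset_refl_Delta a : Wset (reflmx (Delta a)).
Proof. by exists [:: a]; rewrite /= lin_cons aroot_lift mulmx1. Qed.

(** Induction on the height [m]. Some simple root pairs positively with [b], since otherwise
    [ip b b] would be nonpositive. Unless it is [b] itself, reflecting in it keeps [b] positive and
    lowers its height, and the two reflections are conjugate. *)
Lemma Wset_refl_pos b : b \in Phi -> nncomb Delta b -> Wset (reflmx b).
Proof.
have [f fE] := dual_vector (fun=> 1).
have f_nat x : nncomb Delta x -> exists m : nat, ip f x = m%:R.
  move=> [c ->]; exists (\sum_a c a)%N; rewrite ip_sumr natr_sum.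
  by apply: eq_bigr => a _; rewrite ipZr fE mulr1.
move=> bP bp; have [m mE] := f_nat b bp.
elim/ltn_ind: m b bP bp mE => m IH b bP bp mE.
have [a ba] : exists a, 0 < ip b (Delta a).
  apply: contrapT => /forallNP ble; case: (bp) => c cE.
  have := ip_gt0 (root_neq0 bP); rewrite {2}cE ip_sumr ltNge => /negP; apply.
  apply: sumr_le0 => a _; rewrite ipZr mulr_ge0_le0 //.
  by have /negP := ble a; rewrite -leNgt.
have [->|bna] := eqVneq b (Delta a); first exact: Wset_refl_Delta.
have a0 := root_neq0 (root_Delta a).
have sp := refl_Delta_pos bP bp bna.
have sP := root_refl (root_Delta a) bP.
have [m' m'E] := f_nat _ sp.
have m'm : (m' < m)%N.
  rewrite -(ltr_nat R) -m'E -mE reflmxE ipBr ipZr /coroot ipZr fE mulr1.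
  by rewrite ltrBlDr ltrDl mulr_gt0 // divr_gt0 // ip_gt0.
have := IH _ m'm _ sP sp m'E.
have -> : reflmx b = reflmx (Delta a) *m reflmx (b *m reflmx (Delta a)) *m reflmx (Delta a).
  by rewrite -reflmx_conj ?reflmx_orth // -mulmxA reflmxK // mulmx1.
by move=> H; apply: WsetM; [apply: WsetM|]; first 1 last; rewrite //; apply: Wset_refl_Delta.
Qed.

Lemma Wset_refl b : b \in Phi -> Wset (reflmx b).
Proof.
move=> bP; have [bp|bn] := root_sign bP; first exact: Wset_refl_pos.
by rewrite -reflmxN; apply: Wset_refl_pos => //; apply: rootN.
Qed.

(** The affine letter has the reflection in [theta] as linear part, and this too belongs to W. *)
Lemma lin_Wset u : Wset (lin u).
Proof.
elim: u => [|j u IH]; first exact: Wset1.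
by rewrite lin_cons; apply: WsetM => //; apply: Wset_refl; apply: root_aroot.
Qed.

(** An element of W is determined by the images of the simple roots, which lie in the finite list
    [Phi]. *)
Lemma finite_Wset : finite_set Wset.
Proof.
case: HPhi => _ [_ Hfree _ _ _]; set D := \matrix_(a < n) Delta a in Hfree.
have DU : D \in unitmx by rewrite -row_free_unit.
pose F (f : {ffun 'I_n -> seq_sub Phi}) : 'M[R]_n := invmx D *m \matrix_a val (f a).
apply: (@sub_finite_set _ _ (range F)); last exact/finite_image/finite_finset.
move=> _ [u ->]; set w := lin _.
exists [ffun a => SeqSub (root_lin (map (lift ord0) u) (root_Delta a))] => //.
rewrite /F (_ : \matrix_a _ = D *m w) ?mulKmx //.
by apply/row_matrixP => a; rewrite row_mul !rowK ffunE.
Qed.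

(** * Position of alcoves relative to hyperplanes, tested at the base point *)

Section Interior.
Variable z0 : 'rV[R]_n.
Hypothesis Hz0 : interior_A Delta theta z0.

Lemma z0_Delta a : 0 < ip z0 (Delta a). Proof. by case: Hz0. Qed.

Lemma z0_root b : b \in Phi ->
  (nncomb Delta b /\ 0 < ip z0 b < 1) \/ (nncomb Delta (- b) /\ -1 < ip z0 b < 0).
Proof.
have H x : x \in Phi -> nncomb Delta x -> 0 < ip z0 x < 1.
  move=> xP xp; rewrite ip_nncomb_gt0 ?root_neq0 //=; last exact: z0_Delta.
  have := ip_nncomb_ge0 (fun a => ltW (z0_Delta a)) (theta_highest xP).
  by rewrite ipBr; case: Hz0 => _; lra.
move=> bP; have [bp|bn] := root_sign bP; [left|right]; split => //; first exact: H.
by have := H _ (rootN bP) bn; rewrite ipNr; lra.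
Qed.

Lemma z0_pos b : b \in Phi -> 0 < ip z0 b -> nncomb Delta b.
Proof. by move=> /z0_root[[//]|[_]]; lra. Qed.

Lemma pos_z0 b : b \in Phi -> nncomb Delta b -> 0 < ip z0 b.
Proof. by move=> bP bp; rewrite ip_nncomb_gt0 ?root_neq0 //; apply: z0_Delta. Qed.

Lemma alcA_z0 : alcA z0.
Proof. by case: Hz0 => H1 H2; split=> [a|]; apply: ltW. Qed.

(* Every root takes values between two consecutive integers on the fundamental alcove. *)
Lemma alcA_root b g (k : int) : b \in Phi -> alcA g ->
  (k%:~R <= ip z0 b -> k%:~R <= ip g b) /\ (ip z0 b <= k%:~R -> ip g b <= k%:~R).
Proof.
move=> bP [gD gt].
have gpos x : x \in Phi -> nncomb Delta x -> 0 <= ip g x <= 1.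
  move=> xP xp; rewrite ip_nncomb_ge0 //=.
  by have := ip_nncomb_ge0 gD (theta_highest xP); rewrite ipBr; lra.
have intr := @intr_ltD1 R.
have [[bp b01]|[bn b01]] := z0_root bP.
  have g01 := gpos _ bP bp; split=> kb.
    by have := intr k 1; lra.
  by have := intr 0 k; lra.
have g01 := gpos _ (rootN bP) bn; rewrite ipNr in g01; split=> kb.
  by have := intr k 0; lra.
by have := intr (-1) k; lra.
Qed.

Lemma z0_root_int b (k : int) : b \in Phi -> ip z0 b != k%:~R.
Proof.
have intr := @intr_ltD1 R.
move=> /z0_root[[_ h]|[_ h]]; apply/eqP => e; rewrite e in h.
  by have := intr 0 k; lra.
by have := intr (-1) k; lra.
Qed.

Notation wall_sep := (wall_sep Phi Delta theta).
Notation hat_ok := (hat_ok Phi Delta theta).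
Notation chamberC := (chamberC Delta).

(** One interior point stands for its alcove: no root takes an integer value there, so it lies
    strictly on one side of each hyperplane. *)
Definition zpt u : 'rV[R]_n := affapp (word_aff u) z0.

Lemma ip_affapp u g b : ip (affapp (word_aff u) g) b = ip g (b *m (lin u)^T) + ip (trans u) b.
Proof. by rewrite affappE ipDl ip_mulmxl. Qed.

Lemma alc_zpt u : alc u (zpt u).
Proof. by exists z0 => //; apply: alcA_z0. Qed.

(** Pulled back to the fundamental alcove, an integer level stays an integer level, because
    translations pair integrally with roots; and no hyperplane cuts the fundamental alcove. *)
Lemma alc_ge u b (k : int) : b \in Phi ->
  alc u `<=` [set g | k%:~R <= ip g b] <-> k%:~R <= ip (zpt u) b.
Proof.
move=> bP; split=> [|H _ [g gA <-]] /=; first by apply; apply: alc_zpt.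
have [z zE] := trans_int u bP; have [H1 _] := alcA_root (k - z) (root_lin_tr u bP) gA.
by move: H H1; rewrite /zpt !ip_affapp zE rmorphB /=; lra.
Qed.

Lemma alc_le u b (k : int) : b \in Phi ->
  alc u `<=` [set g | ip g b <= k%:~R] <-> ip (zpt u) b <= k%:~R.
Proof.
move=> bP; split=> [|H _ [g gA <-]] /=; first by apply; apply: alc_zpt.
have [z zE] := trans_int u bP; have [_ H1] := alcA_root (k - z) (root_lin_tr u bP) gA.
by move: H H1; rewrite /zpt !ip_affapp zE rmorphB /=; lra.
Qed.

Lemma zpt_neq_int u b (k : int) : b \in Phi -> ip (zpt u) b != k%:~R.
Proof.
move=> bP; have [z zE] := trans_int u bP.
have := z0_root_int (k - z) (root_lin_tr u bP).
by rewrite /zpt ip_affapp zE rmorphB /=; apply: contra_neq => <-; rewrite addrK.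
Qed.

Lemma separatesE u v b (k : int) : b \in Phi -> separates b k (alc u) (alc v) <->
  (k%:~R <= ip (zpt u) b /\ ip (zpt v) b <= k%:~R) \/
  (ip (zpt u) b <= k%:~R /\ k%:~R <= ip (zpt v) b).
Proof. by move=> bP; rewrite /separates !alc_ge // !alc_le. Qed.

(** * Walls of an alcove and separation *)

Definition groot j u := aroot j *m lin u.
(** The wall of type [j] of [alc u] is the hyperplane where [groot j u] takes the value
    [glevel j u]. The point [zpt u] lies above it by [gap j], whatever [u] is. *)
Definition glevel j u := ip (trans u) (groot j u) - alevel j.
Definition gap j := ip z0 (aroot j) + alevel j.

Lemma root_groot j u : groot j u \in Phi.
Proof. by rewrite root_lin // root_aroot. Qed.

Lemma alevel_int j : exists z : int, alevel j = z%:~R.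
Proof. by rewrite /alevel; case: unlift => [_|]; [exists 0|exists 1]. Qed.

Lemma glevel_int j u : exists z : int, glevel j u = z%:~R.
Proof.
have [z zE] := trans_int u (root_groot j u); have [y yE] := alevel_int j.
by exists (z - y); rewrite /glevel zE yE rmorphB.
Qed.

Lemma gap_itv j : 0 < gap j < 1.
Proof.
rewrite /gap /aroot /alevel; case: unlift => [a|].
  have := z0_Delta a; have := z0_root (root_Delta a); lra.
case: Hz0 => _ t1; rewrite ipNr.
(* Comparing [theta] with its own negative shows that twice [ip z0 theta] is nonnegative, so [theta]
   is not a negative root. *)
have := ip_nncomb_ge0 (fun a => ltW (z0_Delta a)) (theta_highest (rootN root_theta)).
by rewrite ipBr ipNr; have := z0_root root_theta; lra.
Qed.

Lemma zpt_cons j u : zpt (j :: u) = zpt u - gap j *: coroot (groot j u).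
Proof.
rewrite /zpt !affappE lin_cons trans_cons mulmxA reflmxE mulmxBl -scalemxAl.
rewrite coroot_mulmx ?lin_orth // /gap scalerDl opprD !addrA.
by congr (_ - _); rewrite -!addrA; congr (_ + _); rewrite addrC.
Qed.

Lemma zpt_groot j u : ip (zpt u) (groot j u) = glevel j u + gap j.
Proof. by rewrite /zpt ip_affapp mulmx_linK /glevel /gap; ring. Qed.

Lemma zpt_cons_groot j u : ip (zpt (j :: u)) (groot j u) = glevel j u - gap j.
Proof.
rewrite zpt_cons ipBl ipZl (ipC (coroot _)) ip_coroot ?root_neq0 ?root_groot //.
by rewrite zpt_groot; ring.
Qed.

(* No hyperplane other than the common wall separates two adjacent alcoves; for the
   affine node this uses that [theta] is the highest root, so that
   [0 <= ip b (coroot theta) <= 1] for positive [b <> theta]. *)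
Lemma sep_A j b (k : int) : b \in Phi ->
  ip (z0 - gap j *: coroot (aroot j)) b <= k%:~R -> k%:~R <= ip z0 b ->
  b = aroot j /\ k%:~R = - alevel j.
Proof.
have intr := @intr_ltD1 R.
move=> bP; rewrite ipBl ipZl /gap /aroot /alevel; case: unlift => [a|].
  rewrite addr0 oppr0 -ipZl -ipBl -reflmxE ip_mulmxl tr_reflmx.
  have aP := root_Delta a; have [[bp b01]|[bn b01]] := z0_root bP.
    have [-> | ba] := eqVneq b (Delta a).
      rewrite reflmx_self ?root_neq0 // ipNr => k1 k2; split=> //.
      by have := z0_root aP; have := intr k 0; have := intr 0 k; lra.
    have := pos_z0 (root_refl aP bP) (refl_Delta_pos bP bp ba).
    by have := intr 0 k; lra.
  have [ba | ba] := eqVneq (- b) (Delta a).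
    have := root_neq0 aP; rewrite -(opprK b) ba mulNmx => /reflmx_self ->.
    rewrite opprK ipNr; have := z0_Delta a; lra.
  have := pos_z0 (root_refl aP (rootN bP)) (refl_Delta_pos (rootN bP) bn ba).
  have := z0_root (root_refl aP (rootN bP)); rewrite mulNmx ipNr.
  by have := intr k 0; have := intr (-1) k; lra.
set t := ip z0 theta; rewrite ipNr corootN ipNl -/t (ipC (coroot _)).
have t0 : 0 < t by have := gap_itv ord0; rewrite /gap /aroot /alevel unlift_none ipNr -/t; lra.
have t1 : t < 1 by case: Hz0.
have zpos x : nncomb Delta x -> 0 <= ip z0 x.
  by apply: ip_nncomb_ge0 => a; apply/ltW/z0_Delta.
(* The reflection of [x] in [theta] is [x - q *: theta]. Comparing it and its negative with [theta]
   gives the lower bound, and [0 <= q] because [ip z0 x] is positive. *)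
have qprop x : x \in Phi -> nncomb Delta x -> exists2 q : int, ip x (coroot theta) = q%:~R &
    0 <= q%:~R :> R /\ (q%:~R - 1) * t <= ip z0 x <= t.
  move=> xP xp; have [q qE] := root_int root_theta xP; exists q => //.
  have sP := root_refl root_theta xP; rewrite reflmx_ip qE in sP.
  have := zpos _ (theta_highest sP); have := zpos _ (theta_highest (rootN sP)).
  have := zpos _ (theta_highest xP); have := zpos _ xp; have := z0_root xP.
  rewrite !ipBr !ipNr !ipBr !ipZr -/t => x01 x0 xt h1 h2; split; last by nra.
  by have := intr q 0; have := intr (-1) q; nra.
have [[bp b01]|[bn b01]] := z0_root bP.
  have [q -> [q0 _]] := qprop _ bP bp => k1 k2.
  have qt : q%:~R * (1 - t) = 0 by nra.
  by have /eqP[] := z0_root_int k bP; nra.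
have [q qE [q0 /andP[qt xt]]] := qprop _ (rootN bP) bn; rewrite ipNr in qt xt.
rewrite ipNl in qE; have -> : ip b (coroot theta) = - q%:~R by rewrite -qE opprK.
move=> k1 k2; have [bt|bt] := eqVneq (- b) theta.
  split; first by rewrite -bt opprK.
  have q2 : q%:~R = 2 :> R by rewrite -qE -ipNl bt ip_coroot ?root_neq0 // root_theta.
  have tE : t = - ip z0 b by rewrite /t -bt ipNr.
  by rewrite q2 in k1 qt; have := intr k 0; have := intr (-2) k; have := intr k (-1);
    have := intr (-1) k; lra.
have : 0 < ip z0 (theta - - b).
  by apply: ip_nncomb_gt0; [exact: z0_Delta|rewrite subr_eq0 eq_sym|exact/theta_highest/rootN].
rewrite ipBr ipNr -/t => bt'.
(* Strict comparison with [theta] turns [(q - 1) * t <= - ip z0 b] into [q < 2]. *)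
have : q%:~R <= 1 :> R by have := intr q 2; have := intr 1 q; nra.
by have := intr k 0; have := intr (-1) k; nra.
Qed.

(** The case of the fundamental alcove, transported by [u]; the integer [z] from the translation
    shifts the level. *)
Lemma sep_cons j u b (k : int) : b \in Phi ->
  ip (zpt (j :: u)) b <= k%:~R -> k%:~R <= ip (zpt u) b ->
  b = groot j u /\ k%:~R = glevel j u.
Proof.
move=> bP; rewrite zpt_cons ipBl /zpt ip_affapp coroot_mulmx ?lin_orth // scalemxAl ip_mulmxl.
have [z zE] := trans_int u bP; rewrite zE => k1 k2.
have := @sep_A j _ (k - z) (root_lin_tr u bP).
rewrite ipBl rmorphB /=; case=> [||bE kE]; [lra|lra|].
have bE' : b = groot j u by rewrite /groot -bE mulmx_lin_trK.
by split=> //; rewrite /glevel -bE' zE -kE; ring.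
Qed.

(** The common wall is the only hyperplane between the two alcoves, and [alc u] lies above it. So
    the wall separates [alc u] from the fundamental alcove exactly when [z0] lies below. *)
Lemma wall_sepE u j : wall_sep u j <-> ip z0 (groot j u) <= glevel j u.
Proof.
have gP := root_groot j u; have gg := zpt_groot j u; have gg' := zpt_cons_groot j u.
have gi := gap_itv j; have zn : zpt [::] = z0 by rewrite /zpt affappE mulmx1 addr0.
split=> [[b [k [[bP bp] []]]]|].
  rewrite !separatesE // zn => -[[k1 k2]|[k1 k2]] k3.
    have [bE kE] := sep_cons bP k2 k1.
    by move: k3; rewrite bE kE gg; lra.
  (* The opposite orientation is reduced to the first by changing the signs of root and level. *)
  have [] := @sep_cons j u (- b) (- k) (rootN bP).
  - by rewrite ipNr rmorphN /=; lra.
  - by rewrite ipNr rmorphN /=; lra.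
  rewrite rmorphN /= => bE kE; rewrite -bE !ipNr in gg *.
  by move: k3; lra.
have [k kE] := glevel_int j u; rewrite kE => H.
have [gp|gn] := root_sign gP.
  exists (groot j u), k; split=> //; rewrite !separatesE // zn gg gg' kE; lra.
exists (- groot j u), (- k); split; first by split=> //; apply: rootN.
by rewrite !separatesE ?rootN // zn !ipNr gg gg' rmorphN /= kE; lra.
Qed.

Lemma alc_chamberE u : alc u `<=` chamberC <-> forall a, 0 < ip (zpt u) (Delta a).
Proof.
split=> [H a|H g gu a].
  rewrite lt_def (zpt_neq_int u 0 (root_Delta a)); exact/H/alc_zpt.
by have /(alc_ge u 0 (root_Delta a))/(_ g gu) := ltW (H a).
Qed.

Lemma alc_nil_chamber : alc [::] `<=` chamberC.
Proof. by move=> _ [g [gA _] <-]; rewrite affappE mulmx1 addr0. Qed.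

(** * Alcoves in the chamber and their admissible walls *)

Section Chamber.
Variables (v : seq 'I_n.+1) (j : 'I_n.+1).
Hypothesis vC : alc v `<=` chamberC.

Lemma chamber_pos b : b \in Phi -> nncomb Delta b -> 0 < ip (zpt v) b.
Proof. by move=> /root_neq0 b0 bp; apply: ip_nncomb_gt0 => //; apply/alc_chamberE. Qed.

Lemma chamber_pos_level0 : glevel j v = 0 -> nncomb Delta (groot j v).
Proof.
move=> g0; have [//|gn] := root_sign (root_groot j v).
have := chamber_pos (rootN (root_groot j v)) gn.
by rewrite ipNr zpt_groot g0; have := gap_itv j; lra.
Qed.

(** Leaving the chamber means crossing some [Delta a] at level zero, which must then be the common
    wall. Conversely a wall of level zero has a positive root, and crossing it makes that root
    negative. *)
Lemma chamber_consE : alc (j :: v) `<=` chamberC <-> glevel j v <> 0.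
Proof.
split=> [/alc_chamberE jC g0|g0].
  have gp := chamber_pos_level0 g0.
  have := ip_nncomb_gt0 jC (root_neq0 (root_groot j v)) gp.
  by rewrite zpt_cons_groot g0; have := gap_itv j; lra.
apply/alc_chamberE => a; rewrite ltNge; apply/negP => a0; apply: g0.
have [] := @sep_cons j v (Delta a) 0 (root_Delta a) a0 => //.
by apply: ltW; move: vC => /alc_chamberE.
Qed.

(** As [0 < gap j < 1], positivity on the chamber makes the integer level nonnegative for a positive
    wall root and at most -1 for a negative one. Since [ip z0] of a root lies strictly between -1
    and 1, a positive wall root is blocked, by the chamber at level zero and by separation above; a
    negative one never is. *)
Lemma hat_okE : hat_ok v j <-> nncomb Delta (- groot j v).
Proof.
have intr := @intr_ltD1 R; have gi := gap_itv j; have gP := root_groot j v.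
have [k kE] := glevel_int j v; have zg := zpt_groot j v.
rewrite /Defs.hat_ok wall_sepE chamber_consE; split=> [[H1 H2]|gn].
  have [gp|//] := root_sign gP; case: H2.
  have := chamber_pos gP gp; have := z0_root gP; rewrite zg kE in H1 *.
  by have := intr (-1) k; have := intr 0 k; lra.
have := chamber_pos (rootN gP) gn; have := z0_root gP; rewrite ipNr zg kE.
by have := intr k 0; lra.
Qed.

End Chamber.

(** * Folding an alcove into the chamber *)

Fixpoint foldv u : seq 'I_n.+1 :=
  if u is j :: u' then
    if `[< alc (j :: foldv u') `<=` chamberC >] then j :: foldv u' else foldv u'
  else [::].

(** The head of a word is its latest crossing. [foldv] processes the crossings in order and drops
    those that would leave the chamber; [foldx] collects the resulting element of W. *)
Definition foldx u : 'M[R]_n := (lin (foldv u))^T *m lin u.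

Lemma foldv_chamber u : alc (foldv u) `<=` chamberC.
Proof.
by elim: u => [|j u IH] /=; [exact: alc_nil_chamber|case: asboolP].
Qed.

Lemma tr_lin u : (lin u)^T = lin (rev u).
Proof.
elim: u => [|j u IH]; first by rewrite /Defs.lin trmx1.
by rewrite lin_cons trmx_mul tr_reflmx IH rev_cons -cats1 lin_cat lin_cons mulmx1.
Qed.

Lemma foldx_lin u : foldx u = lin (rev (foldv u) ++ u).
Proof. by rewrite /foldx tr_lin lin_cat. Qed.

Lemma lin_fold u : lin u = lin (foldv u) *m foldx u.
Proof. by rewrite /foldx mulmxA lin_orth mul1mx. Qed.

Lemma foldx_cons_in j u : alc (j :: foldv u) `<=` chamberC -> foldx (j :: u) = foldx u.
Proof.
move=> H; rewrite /foldx /= asboolT // !lin_cons trmx_mul -mulmxA; congr (_ *m _).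
by rewrite mulmxA tr_reflmx reflmxK ?mul1mx // root_neq0 // root_aroot.
Qed.

(** Moved past [lin (foldv u)], the linear part of the dropped letter becomes the reflection in the
    wall of the folded alcove. *)
Lemma foldx_cons_out j u : ~ alc (j :: foldv u) `<=` chamberC ->
  foldx (j :: u) = reflmx (groot j (foldv u)) *m foldx u.
Proof.
move=> H; rewrite {1}/foldx /= asboolF // lin_cons (lin_fold u).
rewrite [reflmx _ *m _]mulmxA reflmx_conj ?lin_orth // !mulmxA.
by rewrite (mulmx1C (lin_orth _)) mul1mx.
Qed.

(** A dropped letter has level zero: its wall passes through the origin, the affine reflection there
    is linear, and [foldx] absorbs it entirely. *)
Lemma trans_fold u : trans u = trans (foldv u) *m foldx u.
Proof.
elim: u => [|j u IH]; first by rewrite /trans /= mul0mx.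
case: (pselect (alc (j :: foldv u) `<=` chamberC)) => H.
  rewrite foldx_cons_in // [foldv _]/= asboolT // !trans_cons IH mulmxBl.
  by rewrite (lin_fold u) mulmxA scalemxAl.
have g0 : glevel j (foldv u) = 0.
  by apply: contrapT => /(chamber_consE j (@foldv_chamber u)).
rewrite foldx_cons_out // [foldv _]/= asboolF // trans_cons IH (lin_fold u).
move: (foldx u) => x; rewrite !mulmxA reflmxE.
move/eqP: g0; rewrite /glevel subr_eq0 => /eqP ->.
by rewrite mulmxBl /groot coroot_mulmx ?lin_orth // scalemxAl.
Qed.

Lemma groot_fold j u : groot j u = groot j (foldv u) *m foldx u.
Proof. by rewrite /groot lin_fold mulmxA. Qed.

Lemma glevel_fold j u : glevel j u = glevel j (foldv u).
Proof. by rewrite /glevel groot_fold trans_fold ip_orth // foldx_lin lin_orth. Qed.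

(** The two alcoves have the same level, here a nonzero integer. It is compared with numbers
    strictly between -1 and 1, so its sign decides both sides. *)
Lemma fold_wall_sep j u : alc (j :: foldv u) `<=` chamberC ->
  wall_sep u j <-> wall_sep (foldv u) j.
Proof.
move=> /(chamber_consE j (@foldv_chamber u)); rewrite !wall_sepE (glevel_fold j u).
have [k ->] := glevel_int j (foldv u); have intr := @intr_ltD1 R.
have := z0_root (root_groot j u); have := z0_root (root_groot j (foldv u)).
by have := intr k 0; have := intr 0 k; lra.
Qed.

(** At level zero, absence of separation says that [groot j u] is positive at [z0], and
    [groot j (foldv u)] is a positive root anyway. The decrease is a positive multiple of the
    product of their pairings with [z0]. *)
Lemma fold_out_decr j u : ~ alc (j :: foldv u) `<=` chamberC -> ~ wall_sep u j ->
  ip (z0 *m foldx (j :: u)) z0 < ip (z0 *m foldx u) z0.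
Proof.
move=> H; have g0 : glevel j (foldv u) = 0.
  by apply: contrapT => /(chamber_consE j (@foldv_chamber u)).
rewrite wall_sepE glevel_fold g0 => /negP; rewrite -ltNge => gpos.
have gP := root_groot j (foldv u).
have gp := pos_z0 gP (chamber_pos_level0 (@foldv_chamber u) g0).
rewrite foldx_cons_out // mulmxA reflmx_ip mulmxBl ipBl -scalemxAl ipZl -groot_fold (ipC _ z0).
rewrite ltrBlDr ltrDl mulr_gt0 ?(ipC _ z0) // /coroot ipZr mulr_gt0 // divr_gt0 //.
by rewrite ip_gt0 // root_neq0.
Qed.

Lemma alc_center_fold u :
  alc_center Delta theta u = alc_center Delta theta (foldv u) *m foldx u.
Proof. by rewrite /alc_center !affappE lin_fold trans_fold mulmxDl mulmxA. Qed.

End Interior.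
End RootSystem.

(** * The Poisson equation of a finite chain *)

Section Poisson.
Variables (R : realType) (S : eqType) (r : seq S) (A B : S -> S) (p : R) (zeta : S -> R).
Hypothesis Hp : 0 < p < 1.
Hypothesis r_uniq : uniq r.
Hypothesis closedAB : forall x, x \in r -> A x \in r /\ B x \in r.
Hypothesis irred : forall x y, x \in r -> y \in r -> exists m (f : nat -> S),
  [/\ f 0%N = x, f m = y & forall k, (k < m)%N -> f k.+1 = A (f k) \/ f k.+1 = B (f k)].
Hypothesis zeta1 : \sum_(x <- r) zeta x = 1.
Hypothesis stat : forall y, y \in r ->
  zeta y = \sum_(x <- r) zeta x * (p * (y == A x)%:R + (1 - p) * (y == B x)%:R).

Let lap (h : S -> R) x := h x - (p * h (A x) + (1 - p) * h (B x)).

(** Maximum principle: at a maximum both successors have the same value, since both weights are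
    positive, and paths reach every state. *)
Lemma harmonic_const (h : S -> R) : (forall x, x \in r -> lap h x = 0) ->
  forall x y, x \in r -> y \in r -> h x = h y.
Proof.
move=> h0 x y xr yr.
have [z zr zmax] : exists2 z, z \in r & forall y, y \in r -> h y <= h z.
  have i0 : 'I_(size r) by exists (index x r); rewrite index_mem.
  case: (@arg_maxP _ _ _ i0 predT (fun i => h (tnth (in_tuple r) i)) isT) => i _ imax.
  exists (tnth (in_tuple r) i) => [|y' /seq_tnthP[j ->]]; first exact: mem_tnth.
  exact: imax.
suff const y' : y' \in r -> h y' = h z by rewrite !const.
move=> yr'; have [m [f [f0 <- fS]]] := irred zr yr'.
suff H k : (k <= m)%N -> f k \in r /\ h (f k) = h z by have [] := H m (leqnn _).
elim: k => [|k IH] km; first by rewrite f0.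
have [fr fz] := IH (ltnW km); have [Ar Br] := closedAB fr; have := h0 _ fr.
rewrite /lap fz; have := zmax _ Ar; have := zmax _ Br; case/andP: Hp => p0 p1 hB hA e.
by have [->|->] := fS _ km; split=> //; nra.
Qed.

Let m := size r.
Let e : 'I_m -> S := tnth (in_tuple r).

Lemma e_mem i : e i \in r. Proof. exact: mem_tnth. Qed.

Lemma e_inj i j : (e i == e j) = (i == j).
Proof.
apply/eqP/eqP => [|->//]; rewrite /e !(tnth_nth (e i)) /= => /eqP.
by rewrite nth_uniq // => /eqP/val_inj.
Qed.

Let hfun (v : 'rV[R]_m) x : R := \sum_j v 0 j * (e j == x)%:R.
(** [L] acts on row vectors as [lap] acts on functions; stationarity then puts the column of [zeta]
    in its right kernel. *)
Let L : 'M[R]_m := \matrix_(j, i)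
  ((i == j)%:R - (p * (e j == A (e i))%:R + (1 - p) * (e j == B (e i))%:R)).

Lemma hfun_e v i : hfun v (e i) = v 0 i.
Proof.
rewrite /hfun (bigD1 i) //= eqxx mulr1 big1 ?addr0 // => j ji.
by rewrite e_inj (negPf ji) mulr0.
Qed.

Lemma mulmx_L v i : (v *m L) 0 i = lap (hfun v) (e i).
Proof.
rewrite mxE /lap /hfun !mulr_sumr -big_split /= -sumrB; apply: eq_bigr => j _.
by rewrite mxE e_inj (eq_sym i j); ring.
Qed.

(** Fredholm alternative by counting ranks. The left kernel of [L] is at most a line, by the maximum
    principle, and the nonzero column [zc] is killed by [L]. Hence the row space of [L] consists of
    all rows orthogonal to [zc], among them the centred [g]. *)
Lemma poisson (g : S -> R) : exists h : S -> R, forall x, x \in r ->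
  h x - (p * h (A x) + (1 - p) * h (B x)) = g x - \sum_(y <- r) zeta y * g y.
Proof.
set c := \sum_(y <- r) _.
pose zc : 'cV[R]_m := \col_i zeta (e i).
have Lz : L *m zc = 0.
  apply/colP => j; rewrite mxE [RHS]mxE.
  under eq_bigr do rewrite !mxE mulrBl.
  rewrite sumrB (bigD1 j) //= eqxx mul1r big1 ?addr0 => [|i /negPf ->]; last by rewrite mul0r.
  have st := stat (e_mem j); rewrite big_tnth in st; rewrite {1}st; apply/eqP; rewrite subr_eq0; apply/eqP.
  by apply: eq_bigr => i _; rewrite mulrC.
have zc_sum (v : 'rV[R]_m) : (v *m zc) 0 0 = \sum_i v 0 i * zeta (e i).
  by rewrite mxE; apply: eq_bigr => i _; rewrite mxE.
have zc0 : zc != 0.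
  apply/eqP => z0; have := zeta1; rewrite big_tnth big1 => [/eqP|i _].
    by rewrite eq_sym oner_eq0.
  by move/colP: z0 => /(_ i); rewrite !mxE.
have rank_zc : (0 < \rank zc)%N by rewrite lt0n mxrank_eq0.
have ker_L : (kermx L <= (const_mx 1 : 'rV[R]_m))%MS.
  apply/rV_subP => v /sub_kermxP vL.
  have h0 x : x \in r -> lap (hfun v) x = 0.
    by move=> /seq_tnthP[i ->]; rewrite -/(e i) -mulmx_L vL mxE.
  case: (posnP m) => [m0|m0].
    rewrite (_ : v = 0) ?sub0mx //; apply/rowP => i.
    suff i' : 'I_0 by case: i'.
    by rewrite -m0.
  apply/sub_rVP; exists (v 0 (Ordinal m0)); apply/rowP => i; rewrite !mxE mulr1 -!hfun_e.
  by apply: harmonic_const => //; apply: e_mem.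
have rank_L : (m - \rank L <= 1)%N.
  by rewrite -mxrank_ker (leq_trans (mxrankS ker_L)) // rank_leq_row.
have LK : (L <= kermx zc)%MS by apply/sub_kermxP.
(* The inclusion [LK] is an equality: [L] has rank at least [m - 1], and the kernel of [zc] at most
   that. *)
have KL : (kermx zc <= L)%MS.
  rewrite -(mxrank_leqif_sup LK) eqn_leq mxrankS //= mxrank_ker.
  rewrite leq_subLR addnC in rank_L.
  by rewrite leq_subLR (leq_trans rank_L) // leq_add2r.
pose gr : 'rV[R]_m := \row_i (g (e i) - c).
have /submx_trans/(_ KL)/submxP[v vE] : (gr <= kermx zc)%MS.
  apply/sub_kermxP/rowP => i0; rewrite ord1 zc_sum [RHS]mxE.
  under eq_bigr do rewrite mxE mulrBl.
  have -> : c = \sum_i zeta (e i) * g (e i) by rewrite /c big_tnth.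
  rewrite sumrB -mulr_sumr.
  have -> : \sum_i zeta (e i) = 1 by rewrite -zeta1 [RHS]big_tnth.
  rewrite mulr1; apply/eqP; rewrite subr_eq0; apply/eqP.
  by apply: eq_bigr => i _; rewrite mulrC.
exists (hfun v) => x /seq_tnthP[i ->]; rewrite -/(e i).
by rewrite -[LHS]/(lap _ _) -mulmx_L -vE mxE.
Qed.

End Poisson.

(** * Law of large numbers for chains with two successors *)

Section TwoStepChain.
Context (R : realType) (d : measure_display) (Omega : measurableType d).
Variables (P : probability Omega R) (S : countType) (X : nat -> Omega -> S) (x0 : S).
Variables (T : S -> S -> R) (p : R) (a b : S -> S).
Hypothesis HX : markov_chain P X x0 T.
Hypothesis Hp : 0 < p < 1.
Hypothesis HT : forall x y, T x y = p * (y == a x)%:R + (1 - p) * (y == b x)%:R.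
Implicit Types (xs : seq S) (f g : S -> R) (A : set S).

Definition step f x : R := p * f (a x) + (1 - p) * f (b x).

Definition cyl xs : set Omega := [set w | forall j, (j < size xs)%N -> X j w = nth x0 xs j].

Definition pathw xs : R := (head x0 xs == x0)%:R *
  \prod_(j < (size xs).-1) T (nth x0 xs j) (nth x0 xs j.+1).

(** States are countable, so any predicate on them gives a countable union of elementary events. *)
Lemma measurable_state m A : measurable [set w | A (X m w)].
Proof.
rewrite (_ : [set w | _] = \bigcup_x (if `[< A x >] then [set w | X m w = x] else set0)).
  apply: countable_bigcupT_measurable => [|x]; first exact: countableP.
  by case: asbool => //; case: HX.
apply/seteqP; split=> [w Aw|w [x _]] /=; first by exists (X m w) => //; rewrite asboolT.
by case: asboolP => //= Ax ->.
Qed.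

Lemma measurable_cyl xs : measurable (cyl xs).
Proof.
rewrite (_ : cyl xs = \bigcap_(j in `I_(size xs)) [set w | X j w = nth x0 xs j]).
  by apply: fin_bigcap_measurable => [|j _]; [exact: finite_II|case: HX].
by apply/seteqP; split=> w; apply.
Qed.

Lemma prob_cyl xs : (0 < size xs)%N -> P (cyl xs) = (pathw xs)%:E.
Proof. by case: HX => _; apply. Qed.

Lemma pathw_rcons xs y : (0 < size xs)%N ->
  pathw (rcons xs y) = pathw xs * T (last x0 xs) y.
Proof.
case: xs => // x xs _; rewrite /pathw /= size_rcons /= big_ord_recr /= mulrA.
congr (_ * _ * T _ _).
- apply: eq_bigr => j _; rewrite nth_rcons -rcons_cons !nth_rcons /=.
  by rewrite ltnS ltnW ?ltn_ord // (leq_trans (ltn_ord j)).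
- by rewrite -rcons_cons nth_rcons /= ltnSn -[in LHS](last_nth x0).
by rewrite nth_rcons ltnn eqxx.
Qed.

Lemma pathw_ge0 xs : 0 <= pathw xs.
Proof.
rewrite mulr_ge0 // prodr_ge0 // => j _; rewrite HT.
by case/andP: Hp => p0 p1; rewrite addr_ge0 // mulr_ge0 // ?subr_ge0 ltW.
Qed.

Lemma cyl_rcons xs y : cyl (rcons xs y) = cyl xs `&` [set w | X (size xs) w = y].
Proof.
apply/seteqP; split=> [w H|w [H1 /= H2] j].
  split=> [j jx|] /=; last by rewrite H ?size_rcons // nth_rcons ltnn eqxx.
  by rewrite H ?size_rcons ?ltnS 1?ltnW // nth_rcons jx.
rewrite size_rcons ltnS leq_eqVlt nth_rcons => /predU1P[->|jx]; first by rewrite ltnn eqxx.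
by rewrite jx H1.
Qed.

Lemma measure_disj_le (A B C : set Omega) : measurable A -> measurable B -> measurable C ->
  A `&` B = set0 -> A `|` B `<=` C -> (P A + P B <= P C)%E.
Proof.
move=> mA mB mC AB0 ABC; rewrite -measureU //; apply: le_measure => //; rewrite inE //.
exact: measurableU.
Qed.

Lemma ereal_le0 (x : \bar R) (r s : R) : (0 <= x)%E -> (x + r%:E <= s%:E)%E -> s <= r -> x = 0%E.
Proof.
case: x => [x| |] //=; rewrite -?EFinD !lee_fin => y0 yrs sr.
by congr EFin; lra.
Qed.

Lemma prob_setU2 (A B : set Omega) : measurable A -> measurable B ->
  (P (A `|` B) <= P A + P B)%E.
Proof. by move=> mA mB; apply: measureU2. Qed.

Definition badstep xs : set Omega :=
  cyl xs `&` [set w | X (size xs) w <> a (last x0 xs) /\ X (size xs) w <> b (last x0 xs)].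

Lemma measurable_badstep xs : measurable (badstep xs).
Proof.
apply: measurableI; first exact: measurable_cyl.
exact: (measurable_state (size xs) (fun y => y <> a (last x0 xs) /\ y <> b (last x0 xs))).
Qed.

(** The extensions of [xs] by its two successors already carry the whole mass of [cyl xs], as the
    weights add up to one. *)
Lemma prob_badstep xs : (0 < size xs)%N -> P (badstep xs) = 0%E.
Proof.
move=> xs0; set x := last x0 xs.
have mc y : measurable (cyl (rcons xs y)) by apply: measurable_cyl.
have Pc y : P (cyl (rcons xs y)) = (pathw xs * T x y)%:E.
  by rewrite prob_cyl ?size_rcons // pathw_rcons.
(* When the successors coincide, both weights fall on a single cylinder. *)
have [ab|ab] := eqVneq (a x) (b x).
  apply: (@ereal_le0 _ (pathw xs * T x (a x)) (pathw xs)) => //.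
    rewrite -Pc -prob_cyl //; apply: measure_disj_le => //.
    - exact: measurable_badstep.
    - exact: measurable_cyl.
    - by rewrite cyl_rcons; apply/seteqP; split=> // w [[_ /= []]] h _ [_ /= /h].
    - by rewrite cyl_rcons; move=> w [[]|[]].
  by rewrite HT -ab eqxx !mulr1; have := pathw_ge0 xs; lra.
apply: (@ereal_le0 _ (pathw xs * T x (a x) + pathw xs * T x (b x)) (pathw xs)) => //.
  have -> : (pathw xs * T x (a x) + pathw xs * T x (b x))%:E =
     P (cyl (rcons xs (a x)) `|` cyl (rcons xs (b x))).
    rewrite measureU //; first by rewrite EFinD -!Pc.
    rewrite !cyl_rcons; apply/seteqP; split=> // w [[_ /= h1] [_ /= h2]].
    by move/eqP: ab; apply; rewrite -h1.
  rewrite -prob_cyl //; apply: measure_disj_le => //.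
  - exact: measurable_badstep.
  - exact: measurableU.
  - exact: measurable_cyl.
  - rewrite !cyl_rcons; apply/seteqP; split=> // w [[_ /= [h1 h2]] [[_ /= /h1]|[_ /= /h2]]] //.
  - by rewrite !cyl_rcons; move=> w [[]|[[]|[]]].
by rewrite !HT !eqxx [b x == _]eq_sym (negPf ab) !(mulr1, mulr0); have := pathw_ge0 xs; lra.
Qed.

(** Induction on [k], splitting by the first step after [xs] up to the null event [badstep]. Time
    [(size xs).-1] is the last one that [xs] fixes. *)
Lemma prob_cyl_state A k xs : (0 < size xs)%N ->
  (P (cyl xs `&` [set w | A (X ((size xs).-1 + k)%N w)]) <=
   (pathw xs * iter k step (fun x => `[< A x >]%:R) (last x0 xs))%:E)%E.
Proof.
elim: k xs => [|k IH] xs xs0.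
  rewrite addn0 /=; case: asboolP => Ax.
    rewrite mulr1 -prob_cyl //; apply: le_measure; rewrite ?inE //.
    - by apply: measurableI; [exact: measurable_cyl|exact: measurable_state].
    - exact: measurable_cyl.
  rewrite mulr0 (_ : _ `&` _ = set0) ?measure0 //.
  apply/seteqP; split=> // w [/= Hw]; rewrite Hw ?prednK // nth_last.
  exact: Ax.
set x := last x0 xs; set B := [set w | _].
have mB : measurable B by exact: measurable_state.
have BE y : B = [set w | A (X ((size (rcons xs y)).-1 + k)%N w)].
  by rewrite /B size_rcons /= addnS -addSn prednK.
have IHy y : (P (cyl (rcons xs y) `&` B) <=
    (pathw xs * T x y * iter k step (fun x => `[< A x >]%:R) y)%:E)%E.
  have := IH (rcons xs y); rewrite -BE size_rcons pathw_rcons // last_rcons; exact.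
have mCB y : measurable (cyl (rcons xs y) `&` B).
  by apply: measurableI => //; apply: measurable_cyl.
have mbad := measurable_badstep xs.
have bad0 := prob_badstep xs0.
have le1 (C : set Omega) : measurable C -> cyl xs `&` B `<=` badstep xs `|` C ->
    (P (cyl xs `&` B) <= P C)%E.
  move=> mC H; apply: le_trans (_ : P (badstep xs `|` C) <= _)%E.
    apply: le_measure; rewrite ?inE //; first by apply: measurableI => //; exact: measurable_cyl.
    exact: measurableU.
  by apply: (le_trans (prob_setU2 _ _)) => //; rewrite bad0 add0e.
rewrite iterS /step; set F := iter k _ _ in IHy *.
have split_cyl : cyl xs `&` B `<=`
    badstep xs `|` ((cyl (rcons xs (a x)) `&` B) `|` (cyl (rcons xs (b x)) `&` B)).
  move=> w [Cw Bw]; rewrite !cyl_rcons.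
  have [xa|xa] := pselect (X (size xs) w = a x); first by right; left.
  by have [xb|xb] := pselect (X (size xs) w = b x); [right; right|left].
have [ab|ab] := eqVneq (a x) (b x).
  rewrite -ab setUid in split_cyl.
  apply: (le_trans (le1 _ _ split_cyl)) => //; apply: (le_trans (IHy _)).
  by rewrite lee_fin HT -ab eqxx !mulr1; lra.
apply: (le_trans (le1 _ _ split_cyl)); first exact: measurableU.
apply: (le_trans (prob_setU2 _ _)) => //; apply: (le_trans (leeD (IHy _) (IHy _))).
by rewrite -EFinD lee_fin !HT !eqxx [b x == _]eq_sym (negPf ab) !(mulr1, mulr0); lra.
Qed.

Lemma prob_state A k :
  (P [set w | A (X k w)] <= (iter k step (fun x => `[< A x >]%:R) x0)%:E)%E.
Proof.
have p1 : pathw [:: x0] = 1 by rewrite /pathw /= eqxx big_ord0 mulr1.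
have := prob_cyl_state A k (isT : 0 < size [:: x0])%N; rewrite /= add0n p1 mul1r.
apply: le_trans; set B := [set w | _].
have mB : measurable B by exact: measurable_state.
have mc := measurable_cyl [:: x0].
have c0 : P (~` cyl [:: x0]) = 0%E.
  by rewrite probability_setC // prob_cyl // p1 subee.
apply: (@le_trans _ _ (P ((cyl [:: x0] `&` B) `|` ~` cyl [:: x0]))).
  apply: le_measure; rewrite ?inE //.
    by apply: measurableU; [exact: measurableI|exact: measurableC].
  by move=> w Bw; have [|] := pselect (cyl [:: x0] w); [left|right].
apply: (le_trans (prob_setU2 _ _)) => //; [exact: measurableI|exact: measurableC|].
by rewrite c0 adde0.
Qed.

(** A forbidden transition is a [badstep] of the path followed so far. Finite paths are countable,
    enumerated through [unpickle], and each contributes a null event. *)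
Lemma ae_step : {ae P, forall w, X 0 w = x0 /\
  forall m, X m.+1 w = a (X m w) \/ X m.+1 w = b (X m w)}.
Proof.
pose bad k : set Omega := if choice.unpickle k is Some (x, xs) then badstep (x :: xs) else set0.
have mc := measurable_cyl [:: x0].
have bad0 k : P.-negligible (bad k).
  rewrite /bad; case: choice.unpickle => [[x xs]|]; last exact: negligible_set0.
  by apply/negligibleP; [exact: measurable_badstep|exact: prob_badstep].
have cyl0 : P.-negligible (~` cyl [:: x0]).
  apply/negligibleP; first exact: measurableC.
  rewrite -[LHS]/(P (~` cyl [:: x0])) probability_setC // prob_cyl //.
  by rewrite /pathw /= eqxx big_ord0 mulr1 subee.
apply: negligibleS (negligibleU cyl0 (negligible_bigcup bad0)).
move=> w /= H; apply: contrapT => /not_orP[] /contrapT c0 Nbad; apply: H; split.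
  exact: (c0 0%N).
move=> m; apply: contrapT => /not_orP[Na Nb]; apply: Nbad.
exists (choice.pickle (X 0%N w, [seq X j.+1 w | j <- iota 0 m])) => //.
rewrite /bad choice.pickleK; set xs := _ :: _.
have sxs : size xs = m.+1 by rewrite /= size_map size_iota.
have nxs j : (j < m.+1)%N -> nth x0 xs j = X j w.
  by case: j => //= j jm; rewrite (nth_map 0%N) ?size_iota // nth_iota // add0n.
have lxs : last x0 xs = X m w by rewrite -nth_last sxs nxs.
split=> [j jm|]; first by rewrite nxs // -sxs.
by rewrite sxs lxs.
Qed.

(** * Fourth moments and the strong law for an observable of constant drift *)

Section Drift.
Variables (I : S -> Prop) (G : S -> R) (mu C : R).
Hypothesis I0 : I x0.
Hypothesis Iab : forall x, I x -> I (a x) /\ I (b x).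
Hypothesis drift : forall x, I x -> step G x = G x + mu.
Hypothesis incr : forall x, I x -> `|G (a x) - G x| <= C /\ `|G (b x) - G x| <= C.

Let D := C + `|mu|.
(** Along the chain this is a martingale with increments bounded by [D]. *)
Let dev m x := G x - G x0 - m%:R * mu.

Lemma iter_step_le k f g : (forall x, I x -> f x <= g x) ->
  forall x, I x -> iter k step f x <= iter k step g x.
Proof.
move=> fg; elim: k => [|k IH] x Ix; [exact: fg|rewrite /= /step].
have [Ia Ib] := Iab Ix; case/andP: Hp => p0 p1.
by rewrite lerD // ler_wpM2l ?subr_ge0 ?(ltW p0) ?(ltW p1) // IH.
Qed.

Lemma iter_step_lin k f g c e x :
  iter k step (fun x => f x + c * g x + e) x = iter k step f x + c * iter k step g x + e.
Proof. by elim: k x => [|k IH] x //=; rewrite /step !IH; ring. Qed.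

Lemma incr_dev x : I x -> exists al be, [/\ G (a x) = G x + mu + al, G (b x) = G x + mu + be,
  p * al + (1 - p) * be = 0, al ^+ 2 <= D ^+ 2 & be ^+ 2 <= D ^+ 2].
Proof.
move=> Ix; exists (G (a x) - G x - mu), (G (b x) - G x - mu).
have [ia ib] := incr Ix; have := drift Ix; rewrite /step => dx.
have bnd t : `|t| <= C -> (t - mu) ^+ 2 <= D ^+ 2.
  move=> tC; rewrite -(real_normK (num_real (t - mu))).
  rewrite ler_sqr ?nnegrE // ?addr_ge0 ?(le_trans _ tC) //.
  by apply: le_trans (ler_normB _ _) _; rewrite lerD2r.
by split; [ring|ring|nra|exact: bnd|exact: bnd].
Qed.

(** The term linear in the centred increment has mean zero, so each step adds at most [D ^+ 2]. *)
Lemma moment2 m : iter m step (fun x => dev m x ^+ 2) x0 <= D ^+ 2 * m%:R.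
Proof.
elim: m => [|m IH]; first by rewrite /= /dev mul0r subr0 subrr expr0n /= mulr0.
rewrite iterSr; apply: (@le_trans _ _
    (* The summand [0 * 0] gives the shape that [iter_step_lin] expects. *)
    (iter m step (fun x => dev m x ^+ 2 + 0 * 0 + D ^+ 2) x0)).
  apply: iter_step_le => // x Ix; rewrite /step /dev.
  have [al [be [-> -> ab0 alD beD]]] := incr_dev Ix.
  rewrite -(natr1 m); set s := G x - G x0 - m%:R * mu.
  have -> : p * (G x + mu + al - G x0 - (m%:R + 1) * mu) ^+ 2 +
     (1 - p) * (G x + mu + be - G x0 - (m%:R + 1) * mu) ^+ 2 =
     s ^+ 2 + 2 * s * (p * al + (1 - p) * be) + (p * al ^+ 2 + (1 - p) * be ^+ 2).
    by rewrite /s; ring.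
  rewrite ab0; have /andP[/ltW/ler_wpM2l/(_ _ _ alD) h1 p1] := Hp.
  have /ler_wpM2l/(_ _ _ beD) h2 : 0 <= 1 - p by lra.
  by lra.
by rewrite (iter_step_lin m _ (fun=> 0)) -(natr1 m); lra.
Qed.

(* [(s + t) ^+ 4 <= s ^+ 4 + 4 s ^+ 3 t + 8 s ^+ 2 t ^+ 2 + 3 t ^+ 4], and the term linear
   in [t] has mean zero. *)
Lemma moment4 m : iter m step (fun x => dev m x ^+ 4) x0 <= 8 * D ^+ 4 * m%:R ^+ 2.
Proof.
elim: m => [|m IH]; first by rewrite /= /dev mul0r subr0 subrr !expr0n /= mulr0.
rewrite iterSr; apply: (@le_trans _ _
    (iter m step (fun x => dev m x ^+ 4 + (8 * D ^+ 2) * dev m x ^+ 2 + 3 * D ^+ 4) x0)).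
  apply: iter_step_le => // x Ix; rewrite /step /dev.
  have [al [be [-> -> ab0 alD beD]]] := incr_dev Ix.
  rewrite -(natr1 m); set s := G x - G x0 - m%:R * mu.
  have bnd t : t ^+ 2 <= D ^+ 2 ->
      (s + t) ^+ 4 <= s ^+ 4 + 4 * s ^+ 3 * t + 8 * D ^+ 2 * s ^+ 2 + 3 * D ^+ 4.
    move=> tD; have t4 : t ^+ 4 <= D ^+ 4.
      by rewrite -[4%N]/(2 * 2)%N !exprM lerXn2r // nnegrE sqr_ge0.
    have h1 : s ^+ 2 * t ^+ 2 <= s ^+ 2 * D ^+ 2 by rewrite ler_wpM2l // sqr_ge0.
    have h2 : 0 <= t ^+ 2 * (s - t) ^+ 2 by rewrite mulr_ge0 ?sqr_ge0.
    have -> : (s + t) ^+ 4 = s ^+ 4 + 4 * s ^+ 3 * t + 8 * (s ^+ 2 * t ^+ 2) + 3 * t ^+ 4 -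
       2 * (t ^+ 2 * (s - t) ^+ 2) by ring.
    by lra.
  have -> : G x + mu + al - G x0 - (m%:R + 1) * mu = s + al by rewrite /s; ring.
  have -> : G x + mu + be - G x0 - (m%:R + 1) * mu = s + be by rewrite /s; ring.
  have /(ler_wpM2l (ltW (andP Hp).1)) := bnd _ alD.
  have p1 : 0 <= 1 - p by case/andP: Hp => _; lra.
  have /(ler_wpM2l p1) := bnd _ beD.
  move=> h1 h2; apply: le_trans (lerD h2 h1) _.
  rewrite [leLHS](_ : _ = s ^+ 4 + 8 * D ^+ 2 * s ^+ 2 + 3 * D ^+ 4 +
     4 * s ^+ 3 * (p * al + (1 - p) * be)); last by ring.
  by rewrite ab0 mulr0 addr0.
rewrite iter_step_lin -(natr1 m).
have h : 8 * D ^+ 2 * iter m step (fun x => dev m x ^+ 2) x0 <= 8 * D ^+ 2 * (D ^+ 2 * m%:R).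
  by rewrite ler_wpM2l ?moment2 // mulr_ge0 ?sqr_ge0.
apply: le_trans (lerD (lerD IH h) (lexx _)) _.
have D4 : 0 <= D ^+ 4 by rewrite -[4%N]/(2 * 2)%N exprM sqr_ge0.
have mD : 0 <= D ^+ 4 * m%:R by rewrite mulr_ge0.
(* In one step the claimed bound grows by [16 * D ^+ 4 * m + 8 * D ^+ 4], while only
   [8 * D ^+ 4 * m + 3 * D ^+ 4] has to be absorbed. *)
have -> : 8 * D ^+ 4 * (m%:R + 1) ^+ 2 = 8 * D ^+ 4 * m%:R ^+ 2 + 16 * (D ^+ 4 * m%:R) + 8 * D ^+ 4.
  by ring.
have -> : 8 * D ^+ 2 * (D ^+ 2 * m%:R) = 8 * (D ^+ 4 * m%:R) by ring.
by lra.
Qed.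

(** Markov inequality for the fourth power. The resulting bound is summable in [m]; the second
    moment would only give order [1 / m]. *)
Lemma prob_dev (e : R) m : 0 < e ->
  (P [set w | (e * m.+1%:R <= `|dev m (X m w)|)%R] <=
   (8 * D ^+ 4 / e ^+ 4 * m.+1%:R ^- 2)%:E)%E.
Proof.
move=> e0; apply: le_trans (prob_state (fun x => e * m.+1%:R <= `|dev m x|) m) _.
have em0 : 0 < e * m.+1%:R by rewrite mulr_gt0.
rewrite lee_fin; apply: (@le_trans _ _
   (iter m step (fun x => 0 + (e * m.+1%:R) ^- 4 * dev m x ^+ 4 + 0) x0)).
  apply: iter_step_le => // x _; rewrite add0r addr0.
  have ed : 0 <= dev m x ^+ 4 by rewrite -[4%N]/(2 * 2)%N exprM sqr_ge0.
  case: asboolP => [h|_]; last by rewrite mulr_ge0 // invr_ge0 exprn_ge0 // ltW.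
  rewrite mulrC ler_pdivlMr ?exprn_gt0 // mul1r.
  have -> : dev m x ^+ 4 = `|dev m x| ^+ 4.
    by rewrite -normrX ger0_norm.
  by rewrite lerXn2r // nnegrE ltW.
rewrite (iter_step_lin m (fun=> 0)) addr0.
have -> : iter m step (fun=> 0) x0 = 0.
  by elim: (m) (x0) => [|k IH] x //=; rewrite /step !IH; ring.
rewrite add0r; apply: (@le_trans _ _ ((e * m.+1%:R) ^- 4 * (8 * D ^+ 4 * m.+1%:R ^+ 2))).
  rewrite ler_wpM2l // ?invr_ge0 ?exprn_ge0 ?(ltW em0) //.
  apply: le_trans (moment4 m) _; rewrite ler_wpM2l //.
    by rewrite mulr_ge0 // -[4%N]/(2 * 2)%N exprM sqr_ge0.
  by rewrite lerXn2r ?nnegrE // ler_nat.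
by rewrite le_eqVlt; apply/orP; left; apply/eqP; field; rewrite ?pnatr_eq0 ?gt_eqF.
Qed.

Lemma sum_inv_sq_lt (K : R) : 0 <= K -> (\sum_(m <oo) (K * m.+1%:R ^- 2)%:E < +oo)%E.
Proof.
move=> K0; have nn m : (0 <= (K * m.+1%:R ^- 2)%:E)%E.
  by rewrite lee_fin mulr_ge0 // invr_ge0 exprn_ge0.
apply: (@le_lt_trans _ _ (K * 2)%:E); last exact: ltry.
apply: lime_le; first by apply: is_cvg_nneseries => m _ _; apply: nn.
apply: nearW => m; rewrite sumEFin lee_fin -mulr_sumr ler_wpM2l //.
(* This majorant of the partial sums is a telescoping sum dominating each inverse square. *)
apply: (@le_trans _ _ (2 - 2 * m.+1%:R^-1)); last by rewrite gerBl mulr_ge0.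
elim: m => [|m IH]; first by rewrite big_geq // invr1; lra.
rewrite big_nat_recr //=; apply: le_trans (lerD IH (lexx _)) _.
rewrite -(natr1 m.+1); set x : R := m.+1%:R; have x1 : 1 <= x by rewrite ler1n.
have y0 : 0 < x^-1 by rewrite invr_gt0; lra.
have z0 : 0 < (x + 1)^-1 by rewrite invr_gt0; lra.
rewrite -exprVn -subr_ge0.
have -> : 2 - 2 * (x + 1)^-1 - (2 - 2 * x^-1 + x^-1 ^+ 2) =
    x^-1 ^+ 2 * (x + 1)^-1 * (x - 1) by field; rewrite !gt_eqF; lra.
by rewrite mulr_ge0 ?subr_ge0 // mulr_ge0 ?sqr_ge0 // ltW.
Qed.

(** Borel-Cantelli for each tolerance [1 / (r + 1)], followed by a countable union of null sets. *)
Lemma markov_drift_lln :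
  {ae P, forall w, (fun m => m.+1%:R^-1 * G (X m w)) @ \oo --> mu}.
Proof.
have K0 (e : R) : 0 < e -> 0 <= 8 * D ^+ 4 / e ^+ 4.
  move=> e0; rewrite divr_ge0 ?exprn_ge0 ?(ltW e0) // mulr_ge0 //.
  by rewrite -[4%N]/(2 * 2)%N exprM sqr_ge0.
pose E r m := [set w | r.+1%:R^-1 * m.+1%:R <= `|dev m (X m w)| :> R].
have mE r m : measurable (E r m).
  exact: (measurable_state m (fun x => r.+1%:R^-1 * m.+1%:R <= `|dev m x|)).
have E0 r : P.-negligible (lim_sup_set (E r)).
  have r0 : 0 < r.+1%:R^-1 :> R by rewrite invr_gt0.
  apply/negligibleP.
    apply: bigcap_measurable => // k _; apply: bigcup_measurable => m _; exact: mE.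
  apply: lim_sup_set_cvg0 => //; apply: le_lt_trans (sum_inv_sq_lt (K0 _ r0)).
  by apply: lee_nneseries => [m _ _|m _]; [exact: measure_ge0|exact: prob_dev].
apply: negligibleS (negligible_bigcup E0) => w /= H.
apply: contrapT => Hn; apply: H.
have small r : \forall m \near \oo, `|dev m (X m w)| < r.+1%:R^-1 * m.+1%:R.
  have : ~ lim_sup_set (E r) w by move=> Er; apply: Hn; exists r.
  move=> /existsNP[k] /not_implyP[_ Ek]; exists k => // m /= km.
  by rewrite ltNge; apply/negP => Em; apply: Ek; exists m.
have dev0 : (fun m => m.+1%:R^-1 * dev m (X m w)) @ \oo --> (0 : R).
  apply/cvgrPdist_lt => e e0; have [r re] : exists r : nat, r.+1%:R^-1 < e.
    by have := ltr_add_invr e0; case=> r; rewrite add0r; exists r.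
  near=> m; rewrite sub0r normrN normrM ger0_norm ?invr_ge0 //.
  rewrite mulrC ltr_pdivrMr //; apply: (@lt_trans _ _ (r.+1%:R^-1 * m.+1%:R)).
    by near: m; apply: small.
  by rewrite ltr_pM2r.
(* [dev m] subtracts [m] drifts whereas the normalisation is by [m + 1]; the missing drift is put
   with the vanishing term. *)
have -> : (fun m => m.+1%:R^-1 * G (X m w)) = (fun m => m.+1%:R^-1 * dev m (X m w) +
   (m.+1%:R^-1 * (G x0 - mu) + mu)).
  by apply/funext => m; rewrite /dev -(natr1 m); field; rewrite natr1 pnatr_eq0.
rewrite -[X in _ --> X]add0r; apply: cvgD dev0 _.
rewrite -[X in _ --> X]add0r; apply: cvgD; last exact: cvg_cst.
by rewrite -(mul0r (G x0 - mu)); apply: cvgMl; exact: cvg_harmonic.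
Unshelve. all: by end_near. Qed.

End Drift.

End TwoStepChain.

(** * Directions of the trajectories *)

Section Directions.
Variables (R : realType) (n : nat).
Implicit Types (g l : 'rV[R]_n) (w : 'M[R]_n).

Lemma unitvZ (c : R) g : 0 < c -> unitv (c *: g) = unitv g.
Proof.
move=> c0; rewrite /unitv ipZl ipZr mulrA sqrtrM ?mulr_ge0 ?ltW //.
by rewrite -expr2 sqrtr_sqr gtr0_norm // scalerA invfM mulrAC mulVf ?gt_eqF // mul1r.
Qed.

Lemma unitv_mulmx g w : w *m w^T = 1%:M -> unitv (g *m w) = unitv g *m w.
Proof. by move=> wK; rewrite /unitv ip_orth // -scalemxAl. Qed.

Lemma cvg_bigsum (I : Type) (r : seq I) (f : I -> nat -> R) (l : I -> R) :
  (forall k, f k @ \oo --> l k) ->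
  (fun m => \sum_(k <- r) f k m) @ \oo --> \sum_(k <- r) l k.
Proof.
move=> fl; elim: r => [|k r IH].
  by under eq_fun do rewrite big_nil; rewrite big_nil; apply: cvg_cst.
by under eq_fun do rewrite big_cons; rewrite big_cons; apply: cvgD.
Qed.

Lemma cvg_row (g : nat -> 'rV[R]_n) l :
  (forall c, (fun m => g m 0 c) @ \oo --> l 0 c) -> g @ \oo --> l.
Proof.
move=> gl; apply/cvg_ballP => e e0.
have H (c : 'I_n) : \forall m \near \oo, ball (l 0 c) e (g m 0 c).
  by have /cvg_ballP := gl c; apply.
change (\forall m \near \oo, ball l e (g m)).
apply: filterS (filter_forall _ H) => m Hm.
by split=> // a b; rewrite (ord1 a).
Qed.

Lemma cvg_unitv (g : nat -> 'rV[R]_n) l : l != 0 ->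
  (forall c, (fun m => g m 0 c) @ \oo --> l 0 c) ->
  forall c, (fun m => unitv (g m) 0 c) @ \oo --> unitv l 0 c.
Proof.
move=> l0 gl c.
under eq_fun do rewrite /unitv mxE; rewrite /unitv mxE.
apply: cvgM => //; apply: cvgV; first by rewrite gt_eqF // sqrtr_gt0 ip_gt0.
apply: (cvg_comp (fun m => ip (g m) (g m)) (@Num.sqrt R)); last exact: sqrt_continuous.
by apply: cvg_bigsum => k; apply: cvgM.
Qed.

Lemma cvg_bounded_harmonic (f : nat -> R) (C : R) : (forall m, `|f m| <= C) ->
  (fun m => m.+1%:R^-1 * f m) @ \oo --> (0 : R).
Proof.
move=> fC.
have h : (fun m => m.+1%:R^-1 * C) @ \oo --> (0 : R).
  by rewrite -[X in _ --> X](mul0r C); apply: cvgMl; exact: cvg_harmonic.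
have h' : (fun m => - (m.+1%:R^-1 * C)) @ \oo --> (0 : R).
  by rewrite -[X in _ --> X]oppr0; apply: cvgN.
apply: (squeeze_cvgr _ h' h); apply: nearW => m.
by rewrite -ler_norml normrM ger0_norm ?invr_ge0 // ler_wpM2l ?invr_ge0.
Qed.

(** Among the finitely many values attained, take one minimising [f]; after a time when it is
    attained, no strict descent is possible. *)
Lemma eventually_const (T : eqType) (s : seq T) (x : nat -> T) (f : T -> R) :
  (forall m, x m \in s) ->
  (forall m, x m.+1 = x m \/ f (x m.+1) < f (x m)) ->
  exists M, forall m, (M <= m)%N -> x m = x M.
Proof.
move=> xs xS.
have desc M k : x (M + k)%N = x M \/ f (x (M + k)%N) < f (x M).
  elim: k => [|k IH]; first by rewrite addn0; left.
  rewrite addnS; have [->//|lt1] := xS (M + k)%N.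
  by right; case: IH => [<-//|]; apply: lt_trans.
pose s' := [seq y <- s | `[< exists m, x m = y >]].
have s'P m : x m \in s' by rewrite mem_filter xs andbT; apply/asboolP; exists m.
have i0 : 'I_(size s') by exists (index (x 0%N) s'); rewrite index_mem.
case: (@arg_minP _ _ _ i0 predT (fun i => f (tnth (in_tuple s') i)) isT) => i _ imin.
have : tnth (in_tuple s') i \in s' by apply: mem_tnth.
rewrite mem_filter => /andP[/asboolP[M ME] _]; exists M => m Mm.
have [|] := desc M (m - M)%N; rewrite subnKC // => lt1.
have /seq_tnthP[j jE] := s'P m; have := imin j isT.
by rewrite -jE -ME leNgt lt1.
Qed.

End Directions.

(** * The three chains, each with a move and a stay *)

Section Billiard.
Variables (R : realType) (n : nat).
Variables (Phi : seq 'rV[R]_n) (Delta : 'I_n -> 'rV[R]_n) (theta : 'rV[R]_n).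
Hypothesis HPhi : root_system Phi Delta theta.
Variable z0 : 'rV[R]_n.
Hypothesis Hz0 : interior_A Delta theta z0.
Variables (i : nat -> 'I_n.+1) (N : nat) (p : R).
Hypothesis N0 : (0 < N)%N.
Hypothesis Hp : 0 < p < 1.
Hypothesis Hirr : irreducible_W Phi Delta theta i N p.
Variable zeta : 'M[R]_n * nat -> R.
Hypothesis Hzeta : stationary_W Phi Delta theta i N p zeta.

Notation lin := (lin Delta theta).
Notation alc := (alc Delta theta).
Notation Wset := (Wset Delta theta).
Notation trans := (trans Delta theta).
Notation chamberC := (chamberC Delta).
Notation hat_ok := (hat_ok Phi Delta theta).
Notation wall_sep := (wall_sep Phi Delta theta).
Notation hat_repr := (hat_repr Delta theta).
Notation foldv := (foldv Delta theta).
Notation foldx := (foldx Delta theta).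
Notation state := (seq 'I_n.+1 * nat)%type.
Notation psi := (psi Phi Delta theta i N zeta).
Notation Mstates := (Mstates Delta theta N).

Definition nextk (k : nat) := (k.+1 %% N)%N.
Definition stay (S : Type) (x : S * nat) := (x.1, nextk x.2).
(** A refused move coincides with [stay], so in every state the kernel has the form [p] times one
    successor plus [1 - p] times the other. *)
Definition tilde_move (x : state) : state :=
  (if `[< ~ wall_sep x.1 (i x.2) >] then i x.2 :: x.1 else x.1, nextk x.2).
Definition hat_move (x : state) : state :=
  (if `[< hat_ok x.1 (i x.2) >] then i x.2 :: x.1 else x.1, nextk x.2).
Definition W_move (x : 'M[R]_n * nat) : 'M[R]_n * nat :=
  (if `[< hat_ok (hat_repr x.1) (i x.2) >] then lin (i x.2 :: hat_repr x.1) else x.1,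
   nextk x.2).

Lemma trans_tildeE x y : trans_tilde Phi Delta theta i N p x y =
  p * (y == tilde_move x)%:R + (1 - p) * (y == stay x)%:R.
Proof.
by rewrite /trans_tilde /tilde_move /stay /nextk; case: asboolP => // _; ring.
Qed.

Lemma trans_hatE x y : trans_hat Phi Delta theta i N p x y =
  p * (y == hat_move x)%:R + (1 - p) * (y == stay x)%:R.
Proof.
by rewrite /trans_hat /hat_move /stay /nextk; case: asboolP => // _; ring.
Qed.

Lemma trans_WE x y : trans_W Phi Delta theta i N p x y =
  p * (y == W_move x)%:R + (1 - p) * (y == stay x)%:R.
Proof.
by rewrite /trans_W /W_move /stay /nextk; case: asboolP => // _; ring.
Qed.

Lemma trans_W_gt0 x y : 0 < trans_W Phi Delta theta i N p x y -> y = W_move x \/ y = stay x.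
Proof.
rewrite trans_WE; have [->|_] := eqVneq y (W_move x); first by left.
by have [->|_] := eqVneq y (stay x); [right|rewrite !mulr0 addr0 ltxx].
Qed.

Lemma nextk_lt k : (nextk k < N)%N.
Proof. by rewrite ltn_mod. Qed.

(* Representatives in the chamber propagate along the paths that irreducibility provides. *)
Lemma hat_reprP w : Wset w -> alc (hat_repr w) `<=` chamberC /\ lin (hat_repr w) = w.
Proof.
suff ex : Wset w -> exists v, [set v | alc v `<=` chamberC /\ lin v = w] v.
  by move=> /ex; apply: xgetPex.
move=> Ww; pose good (x : 'M[R]_n * nat) := exists v, alc v `<=` chamberC /\ lin v = x.1.
have Sx : Mstates (1%:M, 0%N) by split=> //=; apply: Wset1.
have Sy : Mstates (w, 0%N) by split.
have [m [f [f0 fm fS]]] := Hirr Sx Sy.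
suff H k : (k <= m)%N -> good (f k) by have := H m (leqnn m); rewrite fm.
elim: k => [|k IH] km.
  by rewrite f0; exists [::]; split=> //; apply: (alc_nil_chamber (theta := theta)).
have {}IH := IH (ltnW km).
have rP : alc (hat_repr (f k).1) `<=` chamberC /\ lin (hat_repr (f k).1) = (f k).1.
  exact: xgetPex IH.
have [->|->] := trans_W_gt0 (fS _ km); last by [].
rewrite /good /W_move /=; case: asboolP => [[_ jC]|_]; last exact: IH.
by exists (i (f k).2 :: hat_repr (f k).1).
Qed.

Definition proj (x : state) := (lin x.1, x.2).

(** By [hat_okE] admissibility depends on the linear part only, so the chosen representative does
    not matter. *)
Lemma proj_hat_move x : alc x.1 `<=` chamberC -> proj (hat_move x) = W_move (proj x).
Proof.
move=> xC; rewrite /proj /hat_move /W_move /=; congr pair.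
have [rC rE] := hat_reprP (lin_Wset HPhi x.1).
have -> : `[< hat_ok (hat_repr (lin x.1)) (i x.2) >] = `[< hat_ok x.1 (i x.2) >].
  by apply: asbool_equiv_eq; rewrite !(hat_okE HPhi Hz0) // /groot rE.
by case: asbool => //; rewrite !lin_cons rE.
Qed.

Lemma hat_move_chamber x : alc x.1 `<=` chamberC -> alc (hat_move x).1 `<=` chamberC.
Proof. by move=> xC; rewrite /hat_move /=; case: asboolP => // -[]. Qed.

Definition foldst (x : state) : state := (foldv x.1, x.2).

(** If the folded letter stays in the chamber, both chains test the same separation. Otherwise the
    hat chain refuses it, and [foldv] drops it when the tilde chain accepts it. *)
Lemma fold_tilde_move x : foldst (tilde_move x) = hat_move (foldst x).
Proof.
rewrite /foldst /tilde_move /hat_move /=; congr pair.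
set v := foldv x.1; set j := i x.2; have vC : alc v `<=` chamberC by apply: foldv_chamber.
case: (pselect (alc (j :: v) `<=` chamberC)) => H.
  have -> : `[< hat_ok v j >] = `[< ~ wall_sep x.1 j >].
    apply: asbool_equiv_eq; rewrite /Defs.hat_ok (fold_wall_sep HPhi Hz0 H).
    by split=> [[]|].
  by case: asbool => //=; rewrite asboolT.
have -> : `[< hat_ok v j >] = false by apply: asboolF => -[].
by case: asbool => //=; rewrite asboolF.
Qed.

(** * The finite state space as a list, and positivity of the stationary weights *)

Definition Ws : seq 'M[R]_n := fset_set Wset.
Definition states : seq ('M[R]_n * nat) := [seq (w, k) | w <- Ws, k <- iota 0 N].

Lemma mem_Ws w : w \in Ws <-> Wset w.
Proof. by rewrite /Ws in_fset_set ?inE //; apply: finite_Wset HPhi. Qed.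

Lemma mem_states x : x \in states <-> Mstates x.
Proof.
case: x => w k; rewrite /Defs.Mstates /=; split.
  by move=> /allpairsP[[w' k'] /= [/mem_Ws Ww]]; rewrite mem_iota /= => kN [-> ->].
by move=> [/mem_Ws Ww kN]; apply/allpairsP; exists (w, k); rewrite mem_iota.
Qed.

Lemma states_uniq : uniq states.
Proof.
apply: allpairs_uniq; [exact: fset_uniq|exact: iota_uniq|].
by move=> [x k] [y l] _ _ [-> ->].
Qed.

Lemma sum_Mstates (F : 'M[R]_n * nat -> R) : \sum_(x \in Mstates) F x = \sum_(x <- states) F x.
Proof.
have -> : Mstates = [set` states] by apply/seteqP; split=> x /= /mem_states.
by rewrite -fsbig_seq // states_uniq.
Qed.

Lemma states_closed x : x \in states -> W_move x \in states /\ stay x \in states.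
Proof.
move=> /mem_states[Wx kN]; split; apply/mem_states; split=> //=; rewrite ?nextk_lt //.
by case: asbool => //; apply: lin_Wset HPhi _.
Qed.

Lemma states_irred x y : x \in states -> y \in states -> exists m (f : nat -> 'M[R]_n * nat),
  [/\ f 0%N = x, f m = y & forall k, (k < m)%N -> f k.+1 = W_move (f k) \/ f k.+1 = stay (f k)].
Proof.
move=> /mem_states Sx /mem_states Sy; have [m [f [f0 fm fS]]] := Hirr Sx Sy.
by exists m, f; split=> // k /fS /trans_W_gt0.
Qed.

Lemma zeta_sum1 : \sum_(x <- states) zeta x = 1.
Proof. by case: Hzeta => _ <- _; rewrite sum_Mstates. Qed.

Lemma zeta_stat y : y \in states -> zeta y =
  \sum_(x <- states) zeta x * (p * (y == W_move x)%:R + (1 - p) * (y == stay x)%:R).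
Proof.
move=> /mem_states Sy; case: Hzeta => _ _ /(_ _ Sy) {1}->; rewrite sum_Mstates.
by apply: eq_bigr => x _; rewrite trans_WE.
Qed.

Lemma zeta_ge0 x : x \in states -> 0 <= zeta x.
Proof. by move=> /mem_states Sx; case: Hzeta => /(_ _ Sx). Qed.

(** Some state has positive weight, and stationarity carries positivity along the paths of the
    irreducible chain. *)
Lemma zeta_gt0 y : y \in states -> 0 < zeta y.
Proof.
move=> yr.
have [x xr x0] : exists2 x, x \in states & 0 < zeta x.
  apply: contrapT => H; have := zeta_sum1; rewrite big_seq big1 => [/eqP|x xr].
    by rewrite eq_sym oner_eq0.
  apply/le_anti; rewrite zeta_ge0 // andbT leNgt; apply/negP => x0.
  by apply: H; exists x.
have [m [f [f0 <- fS]]] := states_irred xr yr.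
suff H k : (k <= m)%N -> f k \in states /\ 0 < zeta (f k) by have [] := H m (leqnn m).
elim: k => [|k IH] km; first by rewrite f0.
have [fr fz] := IH (ltnW km); have [Ar Br] := states_closed fr; have := fS _ km => fE.
have fr' : f k.+1 \in states by case: fE => ->.
split=> //; rewrite zeta_stat // (bigD1_seq (f k)) ?states_uniq //=.
case/andP: Hp => p0 p1.
have Kge0 x' y' : 0 <= p * (y' == W_move x')%:R + (1 - p) * (y' == stay x')%:R.
  by rewrite addr_ge0 // mulr_ge0 // ?subr_ge0 ltW.
apply: ltr_pwDl; last first.
  by rewrite big_seq_cond; apply: sumr_ge0 => x' /andP[xr' _]; rewrite mulr_ge0 ?zeta_ge0.
rewrite mulr_gt0 //; case: fE => ->; rewrite eqxx mulr1.
  by rewrite ltr_pwDl // mulr_ge0 // subr_ge0 ltW.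
by rewrite ltr_wpDl ?subr_gt0 // mulr_ge0 // ltW.
Qed.

(** * Growth of the translation and the vector [psi] *)

Lemma trans_cons0 j v : trans (j :: v) = trans v + (j == ord0)%:R *: (coroot theta *m lin v).
Proof.
rewrite trans_cons /alevel /aroot; case: unliftP => [a ->|->].
  by rewrite scale0r subr0 eq_sym (negPf (neq_lift _ _)) scale0r addr0.
by rewrite eqxx corootN mulNmx scalerN opprK.
Qed.

(** Translation added by an accepted move. The [posroot] test is the acceptance criterion of the hat
    chain at the affine letter, and the stationary mean is [psi]. *)
Definition gain (x : 'M[R]_n * nat) : 'rV[R]_n :=
  if (i x.2 == ord0) && `[< posroot Phi Delta (theta *m (invmx x.1)^T) >]
  then coroot theta *m x.1 else 0.

Lemma psiE : psi = \sum_(x <- states) zeta x *: gain x.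
Proof.
rewrite /Defs.psi /states big_allpairs exchange_big /=.
have -> : iota 0 N = index_iota 0 N by rewrite /index_iota subn0.
rewrite big_mkord [LHS]big_mkcond.
apply: eq_bigr => k _; rewrite /gain /=; case: eqP => _ /=; last first.
  by rewrite big1 // => w _; rewrite scaler0.
have fin : finite_set [set w | Wset w /\ posroot Phi Delta (theta *m (invmx w)^T)].
  by apply: sub_finite_set (finite_Wset HPhi) => w [].
rewrite fsbig_finite // [RHS](eq_bigr (fun w =>
   if `[< posroot Phi Delta (theta *m (invmx w)^T) >]
   then zeta (w, val k) *: (coroot theta *m w) else 0)); last first.
  by move=> w _; case: asbool; rewrite ?scaler0.
rewrite -big_mkcond -[RHS]big_filter; apply/perm_big/uniq_perm; first exact: fset_uniq.
  by rewrite filter_uniq // fset_uniq.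
move=> w; rewrite in_fset_set // mem_filter; apply/idP/andP.
  by rewrite inE => -[/mem_Ws Ww wP]; split=> //; apply/asboolP.
by move=> [/asboolP wP /mem_Ws Ww]; rewrite inE.
Qed.

(** By orthogonality the transposed inverse of [lin v] is [lin v] itself. *)
Lemma posroot_gain v : posroot Phi Delta (theta *m (invmx (lin v))^T) <->
  nncomb Delta (theta *m lin v).
Proof.
rewrite (invmx_lin HPhi) trmxK /posroot; split=> [[]//|H]; split=> //.
exact/(root_lin HPhi)/(root_theta HPhi).
Qed.

Lemma hat_move_trans x : alc x.1 `<=` chamberC ->
  trans (hat_move x).1 = trans x.1 + gain (proj x).
Proof.
move=> xC; rewrite /hat_move /gain /=.
case: asboolP => [ok|nok].
  rewrite trans_cons0; case: eqP => [j0|_] /=; last by rewrite scale0r.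
  rewrite scale1r asboolT //; apply/posroot_gain.
  move/(hat_okE HPhi Hz0 _ xC): ok.
  by rewrite /groot /aroot j0 unlift_none mulNmx opprK.
case: eqP => [j0|_] /=; last by rewrite addr0.
rewrite asboolF ?addr0 // => /posroot_gain H; apply: nok.
by apply/(hat_okE HPhi Hz0 _ xC); rewrite /groot /aroot j0 unlift_none mulNmx opprK.
Qed.

Lemma ip_z0_gain x : x \in states -> 0 <= ip z0 (gain x).
Proof.
case: x => w k /mem_states[/= /Wset_lin[v ->] _]; rewrite /gain /=.
case: (i k == ord0); last by rewrite ipC ip0l.
case: asboolP => [/posroot_gain H|_] /=; last by rewrite ipC ip0l.
rewrite /coroot -scalemxAl ipZr mulr_ge0 //.
  by rewrite divr_ge0 // ltW // ip_gt0 // (root_neq0 HPhi) // (root_theta HPhi).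
by apply: ip_nncomb_ge0 H => a; case: Hz0 => H _; apply: ltW.
Qed.

Lemma z0_theta : 0 < ip z0 theta.
Proof.
by have := gap_itv HPhi Hz0 ord0; rewrite /gap /aroot /alevel unlift_none ipNr; lra.
Qed.

(* Otherwise every move out of the identity of W would be refused. *)
Lemma affine_letter : exists2 k, (k < N)%N & i k = ord0.
Proof.
apply: contrapT => H.
have n0 : (0 < n)%N.
  rewrite lt0n; apply/eqP => n0; have := root_neq0 HPhi (root_theta HPhi).
  case/eqP; apply/rowP => c; suff c' : 'I_0 by case: c'.
  by rewrite -n0.
pose a : 'I_n := Ordinal n0.
have Sx : (1%:M, 0%N) \in states by apply/mem_states; split=> //=; apply: Wset1.
have Sy : (reflmx (Delta a), 0%N) \in states.
  by apply/mem_states; split=> //=; apply: Wset_refl_Delta.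
have [m [f [f0 fm fS]]] := states_irred Sx Sy.
suff K k : (k <= m)%N -> (f k).1 = 1%:M /\ ((f k).2 < N)%N.
  have [] := K m (leqnn m); rewrite fm /= => e _.
  have a0 := root_neq0 HPhi (root_Delta HPhi a).
  have := reflmx_self a0; rewrite e mulmx1 => ea.
  have := ip_gt0 a0; rewrite {1}ea ipNl; have := ip_gt0 a0; lra.
elim: k => [|k IH] km; first by rewrite f0.
have [fk1 fkN] := IH (ltnW km).
have [->|->] := fS _ km; split; rewrite ?nextk_lt //= fk1.
have [rC rE] := hat_reprP (Wset1 Delta theta).
case: asboolP => // /(hat_okE HPhi Hz0 _ rC); rewrite /groot rE mulmx1 /aroot.
case: unliftP => [b _|ik]; last by case: H; exists (f k).2.
move=> /(ip_nncomb_ge0 (fun a => ltW (z0_Delta Hz0 a))).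
by rewrite ipNr oppr_ge0 leNgt (z0_Delta Hz0).
Qed.

(** Pair with [z0]: every term is nonnegative, and the identity of W at an affine letter contributes
    strictly, as [theta] is positive. *)
Lemma psi_neq0 : psi != 0.
Proof.
have [k kN ik] := affine_letter.
have Sx : (1%:M, k) \in states by apply/mem_states; split=> //=; apply: Wset1.
suff : 0 < ip z0 psi by apply: contraTneq => ->; rewrite ipC ip0l ltxx.
rewrite psiE ip_sumr (bigD1_seq (1%:M, k)) ?states_uniq //=; apply: ltr_pwDl.
  rewrite ipZr mulr_gt0 ?zeta_gt0 // /gain /= ik eqxx asboolT /=.
    rewrite mulmx1 /coroot ipZr mulr_gt0 ?z0_theta // divr_gt0 // ip_gt0 //.
    by rewrite (root_neq0 HPhi) // (root_theta HPhi).
  rewrite -[1%:M]/(lin [::]); apply/posroot_gain; rewrite mulmx1.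
  by apply: (z0_pos HPhi Hz0) z0_theta; apply: root_theta HPhi.
rewrite big_seq_cond; apply: sumr_ge0 => x /andP[xr _].
by rewrite ipZr mulr_ge0 ?zeta_ge0 ?ip_z0_gain.
Qed.

(** * Corrected coordinates and almost sure limits *)

Definition chamber_state (x : state) := alc x.1 `<=` chamberC /\ (x.2 < N)%N.

Lemma proj_states x : chamber_state x -> proj x \in states.
Proof. by case=> _ xN; apply/mem_states; split=> //=; apply: lin_Wset HPhi _. Qed.

Lemma chamber_state_next x : chamber_state x -> chamber_state (hat_move x) /\ chamber_state (stay x).
Proof.
by case=> xC xN; split; split; rewrite /= ?nextk_lt //; apply: hat_move_chamber.
Qed.

Lemma norm_le_sum (F : 'M[R]_n * nat -> R) y : y \in states -> `|F y| <= \sum_(x <- states) `|F x|.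
Proof.
by move=> yr; rewrite (bigD1_seq y) ?states_uniq //= lerDl sumr_ge0.
Qed.

Definition pot (h : 'M[R]_n * nat -> R) c (x : state) := trans x.1 0 c + h (proj x).

(** The Poisson equation is solved for [p * gain], the mean increment of the translation, since the
    move is proposed with probability [p]. *)
Lemma potential (c : 'I_n) : exists h, forall x, chamber_state x ->
  step p hat_move (@stay _) (pot h c) x = pot h c x + p * psi 0 c.
Proof.
have [h hE] := poisson Hp states_uniq states_closed states_irred zeta_sum1 zeta_stat
  (fun x => p * gain x 0 c).
exists h => x xC; have := hE _ (proj_states xC).
have -> : \sum_(y <- states) zeta y * (p * gain y 0 c) = p * psi 0 c.
  by rewrite psiE summxE mulr_sumr; apply: eq_bigr => y _; rewrite mxE; ring.
rewrite /step /pot hat_move_trans ?proj_hat_move; try by case: xC.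
rewrite -[stay (proj x)]/(proj (stay x)) [(stay x).1]/= mxE.
by move: (h (W_move _)) (h (proj (stay x))) (h (proj x)) => h1 h2 h3 e; lra.
Qed.

Lemma pot_incr h c : exists C, forall x, chamber_state x ->
  `|pot h c (hat_move x) - pot h c x| <= C /\ `|pot h c (stay x) - pot h c x| <= C.
Proof.
pose C1 := \sum_(x <- states) `|gain x 0 c|; pose C2 := \sum_(x <- states) `|h x|.
exists (C1 + (C2 + C2)) => x xC; have [hC sC] := chamber_state_next xC.
have b1 : `|gain (proj x) 0 c| <= C1 by exact: (norm_le_sum (fun x => gain x 0 c)) (proj_states xC).
have hb y : chamber_state y -> `|h (proj y)| <= C2 by move=> /proj_states; apply: norm_le_sum.
rewrite /pot hat_move_trans ?mxE; last by case: xC.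
have C1_ge0 : 0 <= C1 by apply: le_trans b1.
split.
  rewrite (_ : _ - _ = gain (proj x) 0 c + (h (proj (hat_move x)) - h (proj x))); last by ring.
  by rewrite (le_trans (ler_normD _ _)) // lerD // (le_trans (ler_normB _ _)) // lerD // hb.
rewrite (_ : _ - _ = h (proj (stay x)) - h (proj x)); last by rewrite /=; ring.
by rewrite (le_trans (ler_normB _ _)) // ler_wpDl // lerD // hb.
Qed.

(** The centre of the alcove differs from the corrected translation by a function of the finite
    projection, negligible after division by [M + 1]. [unitv] ignores positive factors, hence this
    division and the factor [p]. *)
Lemma direction_cvg (h : 'I_n -> 'M[R]_n * nat -> R) (y : nat -> state) :
  (forall m, chamber_state (y m)) ->
  (forall c, (fun m => m.+1%:R^-1 * pot (h c) c (y m)) @ \oo --> p * psi 0 c) ->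
  forall c, (fun m => unitv (alc_center Delta theta (y m).1) 0 c) @ \oo --> unitv psi 0 c.
Proof.
move=> yC yl c0; have p0 : 0 < p by case/andP: Hp.
pose g m := m.+1%:R^-1 *: alc_center Delta theta (y m).1.
have gE m : unitv (alc_center Delta theta (y m).1) = unitv (g m) by rewrite /g unitvZ // invr_gt0.
rewrite (_ : (fun m => _) = fun m => unitv (g m) 0 c0); last by apply/funext => m; rewrite gE.
rewrite -(unitvZ psi p0); apply: cvg_unitv => [|c].
  by rewrite scaler_eq0 negb_or psi_neq0 gt_eqF.
pose q (x : 'M[R]_n * nat) := (centerA Delta theta *m x.1) 0 c - h c x.
have -> : (fun m => g m 0 c) =
    (fun m => m.+1%:R^-1 * pot (h c) c (y m) + m.+1%:R^-1 * q (proj (y m))).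
  apply/funext => m; rewrite /g /q /pot mxE /alc_center affappE mxE /proj /=; ring.
rewrite mxE -[p * _]addr0; apply: cvgD => //.
apply: (@cvg_bounded_harmonic _ _ (\sum_(x <- states) `|q x|)) => m.
exact/norm_le_sum/proj_states.
Qed.

Lemma hat_direction (d : measure_display) (Omega : measurableType d) (P : probability Omega R)
    (V : nat -> Omega -> state) :
  markov_chain P V ([::], 0%N) (trans_hat Phi Delta theta i N p) ->
  {ae P, forall w, (fun M => unitv (alc_center Delta theta (V M w).1)) @ \oo --> unitv psi}.
Proof.
move=> HV; have [h hE] := choice potential.
have init : chamber_state ([::], 0%N).
  by split=> //; apply: (alc_nil_chamber (theta := theta)).
have lln (c : 'I_n) : {ae P, forall w,
    (fun m => m.+1%:R^-1 * pot (h c) c (V m w)) @ \oo --> p * psi 0 c}.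
  have [C HC] := pot_incr (h c) c.
  exact: (markov_drift_lln HV Hp trans_hatE init chamber_state_next (hE c) HC).
apply: (filterS2 _ _ (ae_step HV Hp trans_hatE) (filter_forall _ lln)) => w [w0 wS] wl.
apply: cvg_row; apply: (direction_cvg _ wl).
elim=> [|m IH]; first by rewrite w0.
by have [] := chamber_state_next IH; have [->|->] := wS m.
Qed.

(** The law of large numbers is applied to the tilde chain with the folded observable, so no hat
    chain is built on this probability space. *)
Lemma tilde_direction (d : measure_display) (Omega : measurableType d) (P : probability Omega R)
    (U : nat -> Omega -> state) :
  markov_chain P U ([::], 0%N) (trans_tilde Phi Delta theta i N p) ->
  {ae P, forall w, exists2 wW, Wset wW &
    (fun M => unitv (alc_center Delta theta (U M w).1)) @ \oo --> unitv psi *m wW}.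
Proof.
move=> HU; have [h hE] := choice potential.
have foldC (x : state) : (x.2 < N)%N -> chamber_state (foldst x).
  by move=> xN; split=> //; apply: foldv_chamber.
have nextI (x : state) : (x.2 < N)%N -> ((tilde_move x).2 < N)%N /\ ((stay x).2 < N)%N.
  by rewrite /= nextk_lt.
have lln (c : 'I_n) : {ae P, forall w,
    (fun m => m.+1%:R^-1 * pot (h c) c (foldst (U m w))) @ \oo --> p * psi 0 c}.
  have [C HC] := pot_incr (h c) c.
  apply: (markov_drift_lln HU Hp trans_tildeE (I := fun x => (x.2 < N)%N)
    (G := pot (h c) c \o foldst) (C := C)) => //= x xN.
    by rewrite -(hE c _ (foldC _ xN)) /step /= fold_tilde_move.
  by rewrite fold_tilde_move; apply: HC (foldC _ xN).
apply: (filterS2 _ _ (ae_step HU Hp trans_tildeE) (filter_forall _ lln)) => w [w0 wS] wl.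
have UN m : ((U m w).2 < N)%N.
  elim: m => [|m IH]; first by rewrite w0.
  by have [] := nextI _ IH; have [->|->] := wS m.
have dir := direction_cvg (fun m => foldC _ (UN m)) wl.
pose x m := foldx (U m w).1.
have xW m : x m \in Ws by apply/mem_Ws; rewrite /x foldx_lin; apply: lin_Wset HPhi _.
have xS m : x m.+1 = x m \/ ip (z0 *m x m.+1) z0 < ip (z0 *m x m) z0.
  rewrite /x; have [->|->] := wS m; last by left.
  rewrite /tilde_move; case: asboolP => [nsep|_] /=; last by left.
  case: (pselect (alc (i (U m w).2 :: foldv (U m w).1) `<=` chamberC)) => H.
    by left; rewrite (foldx_cons_in HPhi H).
  by right; apply: (fold_out_decr HPhi Hz0 H nsep).
have [M xM] := eventually_const (f := fun y => ip (z0 *m y) z0) xW xS.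
exists (x M); first exact/mem_Ws.
have xorth : x M *m (x M)^T = 1%:M by rewrite /x foldx_lin (lin_orth HPhi).
(* From time [M] on, the same orthogonal [x M] carries the folded directions to the actual ones. *)
apply: (@cvg_trans _ ((fun m => unitv (alc_center Delta theta (foldv (U m w).1)) *m x M) @ \oo)).
  apply: near_eq_cvg; exists M => // m /= Mm.
  by rewrite (alc_center_fold HPhi Hz0 (U m w).1) -/(x m) (xM m Mm) unitv_mulmx.
apply: cvg_row => c; rewrite mxE; under eq_fun do rewrite mxE.
by apply: cvg_bigsum => k; apply: cvgMl; apply: dir.
Qed.

End Billiard.

Theorem theorem1p2 (R : realType) (n : nat)
  (Phi : seq 'rV[R]_n) (Delta : 'I_n -> 'rV[R]_n) (theta : 'rV[R]_n)
  (HPhi : root_system Phi Delta theta)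
  (z0 eta : 'rV[R]_n) (Hz0 : interior_A Delta theta z0)
  (Heta : upsilon Phi Delta z0 eta)
  (i : nat -> 'I_n.+1) (Hi : billiard_word Delta theta z0 eta i)
  (N : nat) (HN : period i N)
  (p : R) (Hp : 0 < p < 1)
  (Hirr : irreducible_W Phi Delta theta i N p)
  (zeta : 'M[R]_n * nat -> R) (Hzeta : stationary_W Phi Delta theta i N p zeta)
  (d1 : measure_display) (Omega1 : measurableType d1) (P1 : probability Omega1 R)
  (U : nat -> Omega1 -> seq 'I_n.+1 * nat)
  (HU : markov_chain P1 U ([::], 0%N) (trans_tilde Phi Delta theta i N p))
  (d2 : measure_display) (Omega2 : measurableType d2) (P2 : probability Omega2 R)
  (V : nat -> Omega2 -> seq 'I_n.+1 * nat)
  (HV : markov_chain P2 V ([::], 0%N) (trans_hat Phi Delta theta i N p)) :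
  let psieta := psi Phi Delta theta i N zeta in
  {ae P2, forall w, (fun M => unitv (alc_center Delta theta (fst (V M w)))) @ \oo
                      --> unitv psieta} /\
  {ae P1, forall w, exists2 wW, Wset Delta theta wW &
      (fun M => unitv (alc_center Delta theta (fst (U M w)))) @ \oo
        --> unitv psieta *m wW}.
Proof.
case: HN => N0 _; split.
  exact: (hat_direction HPhi Hz0 N0 Hp Hirr Hzeta HV).
exact: (tilde_direction HPhi Hz0 N0 Hp Hirr Hzeta HU).
Qed.
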